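(* Let $v,w\in I(d,n)$ with $v\le w$. Fix any term order on the monomials in the polynomial ring $k[X_\beta: \beta\in\mathfrak R^v]$ such that, for every $\theta\in I(d,n)$ with $\theta\ge v$, the initial term of $f_\theta$ with respect to this order is (up to sign) the monomial $\mathfrak S_\theta$. Then $\{f_\theta: \theta\in I(d,n),\ v\le\theta\not\le w\}$ is a Gröbner basis (of the ideal it generates) with respect to this order.
   Context: Fix positive integers $d\le n$ and a field $k$. $I(d,n)$ is the set of $d$-element subsets of $\{1,\dots,n\}$, written $v=(v_1<\dots<v_d)$, with partial order $v\le w$ iff $v_i\le w_i$ for all $i$. $\mathfrak R^v=\{(r,c): r\in\{1,\dots,n\}\setminus v,\ c\in v\}$ and $\mathfrak N^v=\{(r,c)\in\mathfrak R^v: r>c\}$. The polynomials $f_\theta$: take indeterminates $X_\beta$, $\beta\in\mathfrak R^v$, and form the $n\times d$ matrix with rows indexed by $1,\dots,n$ and columns indexed by $v_1,\dots,v_d$, whose row $v_i$ is the $i$-th standard unit row vector, and whose entry in row $r\notin v$ and column $c$ is $X_{(r,c)}$. For $\theta\in I(d,n)$, $f_\theta$ is the determinant of the $d\times d$ submatrix consisting of the rows $\theta_1<\dots<\theta_d$. The monomials $\mathfrak S_\theta$: for $\theta\ge v$, let $r_1<\dots<r_p$ be the elements of $\theta\setminus v$; successively for $j=1,\dots,p$ let $c_j$ be the largest element of $(v\setminus\theta)\setminus\{c_1,\dots,c_{j-1}\}$ that is less than $r_j$ (it exists since $\theta\ge v$). Then $\mathfrak S_\theta=\{(r_1,c_1),\dots,(r_p,c_p)\}\subset\mathfrak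 N^v$, also regarded as the monomial $\prod_j X_{(r_j,c_j)}$. *)

(* Defs.v *)
From HB Require Import structures.
From mathcomp Require Import all_boot all_order all_algebra.
From mathcomp.multinomials Require Import mpoly.

Set Implicit Arguments.
Unset Strict Implicit.
Unset Printing Implicit Defensive.

Import GRing.Theory.
Local Open Scope ring_scope.

(* The set {1, ..., n} is represented by 'I_n, i.e. shifted to {0, ..., n-1};
   only the order of its elements matters. *)

Record Idn (d n : nat) : Type :=
  MkIdn { Idn_set :> {set 'I_n}; Idn_card : #|Idn_set| == d }.
HB.instance Definition _ d n := [isSub for @Idn_set d n].
HB.instance Definition _ d n := [Finite of Idn d n by <:].

Lemma card_Idn d n (v : Idn d n) : #|v| = d.
Proof. exact/eqP/Idn_card. Qed.

(* elt v i is the (i+1)-st smallest element of v: enum lists the elements of a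
   set of ordinals in increasing order. *)
Definition elt d n (v : Idn d n) (i : 'I_d) : 'I_n :=
  enum_val (cast_ord (esym (card_Idn v)) i).

Definition Idn_le d n (v w : Idn d n) : bool :=
  [forall i : 'I_d, (elt v i <= elt w i)%N].

Definition Rset d n (v : Idn d n) : {set 'I_n * 'I_n} :=
  [set b | (b.1 \notin v) && (b.2 \in v)].

Record Rtype d n (v : Idn d n) : Type :=
  MkRtype { Rpair :> 'I_n * 'I_n; RpairP : Rpair \in Rset v }.
HB.instance Definition _ d n (v : Idn d n) := [isSub for @Rpair d n v].
HB.instance Definition _ d n (v : Idn d n) := [Finite of Rtype v by <:].

(* The number of indeterminates; X_b is the variable of index enum_rank b. *)
Definition nvars d n (v : Idn d n) : nat := #|{: Rtype v}|.

Section Polynomials.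
Variables (k : fieldType) (d n : nat) (v : Idn d n).

(* X_(r,c), with the junk value 0 when (r,c) is not in R^v. *)
Definition Xvar (r c : 'I_n) : {mpoly k[nvars v]} :=
  if insub (r, c) is Some b then 'X_(enum_rank (b : Rtype v)) else 0.

Definition generic_mx : 'M[{mpoly k[nvars v]}]_(n, d) :=
  \matrix_(r < n, j < d)
    if r \in v then (r == elt v j)%:R else Xvar r (elt v j).

Definition fpoly (theta : Idn d n) : {mpoly k[nvars v]} :=
  \det (rowsub (elt theta) generic_mx).

End Polynomials.

Definition largest_below n (A : {set 'I_n}) (r : 'I_n) : option 'I_n :=
  [pick c in A | (c < r)%N && [forall c' in A, (c' < r)%N ==> (c' <= c)%N]].

(* The rows are processed in the order of the list; the case None does not
   occur in S_theta when v <= theta. *)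
Fixpoint greedy_pairs n (rs : seq 'I_n) (A : {set 'I_n}) : seq ('I_n * 'I_n) :=
  if rs is r :: rs' then
    if largest_below A r is Some c then (r, c) :: greedy_pairs rs' (A :\ c)
    else greedy_pairs rs' A
  else [::].

Definition Sset d n (v theta : Idn d n) : seq ('I_n * 'I_n) :=
  greedy_pairs (enum (theta :\: v)) (v :\: theta).

Definition Smon d n (v theta : Idn d n) : 'X_{1..nvars v} :=
  [multinom count_mem (Rpair (enum_val i)) (Sset v theta) | i < nvars v].

(* le m1 m2 reads m1 <= m2. Monomials are written additively: 0%MM is the
   monomial 1 and (m1 + m2)%MM is the product. *)
Definition term_order N (le : rel 'X_{1..N}) : Prop :=
  [/\ antisymmetric le, transitive le, total le,
      forall m, le 0%MM m
    & forall m m1 m2, le m1 m2 -> le (m1 + m)%MM (m2 + m)%MM].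

Section Groebner.
Variables (k : fieldType) (N : nat) (le : rel 'X_{1..N}).
Implicit Types (p q : {mpoly k[N]}).

(* Since 0%MM is minimal for a term order, this is the largest monomial of the
   support of p when p is nonzero. *)
Definition init_mon p : 'X_{1..N} :=
  foldr (fun m m' => if le m m' then m' else m) 0%MM (msupp p).

(* With its coefficient; init_term 0 = 0. *)
Definition init_term p : {mpoly k[N]} := p@_(init_mon p) *: 'X_[init_mon p].

Definition ideal_gen (G : {mpoly k[N]} -> Prop) (p : {mpoly k[N]}) : Prop :=
  exists2 s : seq ({mpoly k[N]} * {mpoly k[N]}),
    forall ag, ag \in s -> G ag.2 & p = \sum_(ag <- s) ag.1 * ag.2.

Definition init_ideal (I : {mpoly k[N]} -> Prop) : {mpoly k[N]} -> Prop :=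
  ideal_gen (fun q => exists2 p, I p & q = init_term p).

(* G is a Groebner basis of the ideal it generates. *)
Definition groebner_basis (G : seq {mpoly k[N]}) : Prop :=
  forall p, init_ideal (ideal_gen (fun g => g \in G)) p <->
            ideal_gen (fun q => exists2 g, g \in G & q = init_term g) p.

End Groebner.

(* Main.v *)
(* Label the rows of the matrix of indeterminates by the complement of v in
   decreasing order and its columns by v in increasing order. The f_theta with
   theta not below w then lie in a sum I of ideals of t-minors of rectangles
   A x B having the origin as a corner: for each threshold x, take the rows
   >= x, the columns < x, and t = #{i in w, i >= x} - #{i in v, i >= x} + 1. A
   strictly increasing chain of t cells in such a rectangle is S_theta for some
   theta >= v not below w, so it suffices that in(I) is the ideal J_I of the
   monomials whose support contains such a chain for one of the conditions
   (A, B, t).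

   This is proved by induction on the family of conditions, by linkage. After
   discarding redundant conditions choose one, (A, B, t), with a largest
   rectangle, and let z be the cell of that rectangle opposite to the origin. Let
   N be obtained from I by replacing (A, B, t) by (A-1, B, t) and (A, B-1, t),
   and L by replacing it by (A-1, B-1, t-1); then J_I = z J_L + J_N. If f and F
   are t-minors through z, with cofactors g and G of z, then gF - fG is in N.
   Hence every p in I has a companion q in L such that gp - fq is in N for all
   pairs (f, g). For every monomial m outside J_N some g satisfies that m in(g)
   is outside J_N (chain_extension). Since in(N) = J_N and in(f) = z in(g),
   comparing the initial terms of gp and fq for well chosen g gives
   in(p) = z in(q), unless in(p) is in J_N. *)

Require Import Defs.
From mathcomp Require Import all_boot all_order all_algebra.
From mathcomp.multinomials Require Import mpoly.
From Stdlib Require Import Classical_Prop.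
From mathcomp Require Import perm zify ring.

Set Implicit Arguments.
Unset Strict Implicit.
Unset Printing Implicit Defensive.

Import GRing.Theory.
Local Open Scope ring_scope.

(** * Determinants *)

(** Multiplying the bordered matrix on the right by a block upper triangular matrix of determinant
    [\det U ^+ s] makes it block lower triangular. The power can be cancelled because a monic
    determinant is regular. *)
Lemma det_bordered_monic (R : comNzRingType) s (U : 'M[{poly R}]_s)
    (b : 'cV_s) (a : 'rV_s) (z : 'M_1) :
  \det U \is monic ->
  \det (block_mx U b a z) = z 0 0 * \det U - (a *m \adj U *m b) 0 0.
Proof.
move=> mU.
have regU : GRing.lreg (\det U ^+ s) by apply/lregX/monic_lreg.
apply: regU.
have detA : \det (\adj U) * \det U = \det U ^+ s.
  by rewrite -det_mulmx mul_adj_mx det_scalar.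
rewrite mulrC -{1}detA.
have <- : \det (block_mx (\adj U) (- (\adj U *m b)) 0 (\det U)%:M)
          = \det (\adj U) * \det U.
  by rewrite det_ublock det_scalar1.
rewrite -det_mulmx mulmx_block !mulmx0 !addr0 !mulmxN.
rewrite (mulmxA U) (mulmxA a).
rewrite mul_mx_adj mul_mx_scalar mul_scalar_mx addNr det_lblock det_scalar.
congr (_ * _); rewrite det_mx11 mul_mx_scalar mxE addrC.
by rewrite [X in X + _]mxE [X in _ + X]mxE mulrC.
Qed.

(* det U becomes regular once U is replaced by U + X. *)
Lemma det_bordered (R : comNzRingType) s (U : 'M[R]_s)
    (b : 'cV_s) (a : 'rV_s) (z : 'M_1) :
  \det (block_mx U b a z) = z 0 0 * \det U - (a *m \adj U *m b) 0 0.
Proof.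
pose UX : 'M[{poly R}]_s := char_poly_mx (- U).
pose c m n (A : 'M[R]_(m, n)) := map_mx polyC A.
have mU : \det UX \is monic by exact: char_poly_monic.
have := det_bordered_monic (c _ _ b) (c _ _ a) (c _ _ z) mU.
move/(congr1 (horner_eval (0 : R))).
have ev m n (A : 'M[R]_(m, n)) : map_mx (horner_eval 0) (c _ _ A) = A.
  by apply/matrixP=> i j; rewrite !mxE /horner_eval hornerC.
have evU : map_mx (horner_eval 0) UX = U.
  apply/matrixP=> i j; rewrite !mxE /horner_eval.
  by rewrite hornerD hornerN hornerC hornerMn hornerX mul0rn add0r opprK.
rewrite rmorphB rmorphM -!det_map_mx map_block_mx evU !ev /= => ->.
congr (_ * _ - _); first by rewrite mxE /horner_eval hornerC.
rewrite -[RHS](_ : (map_mx (horner_eval 0) (c _ _ a *m \adj UX *m c _ _ b)) 0 0 = _).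
  by rewrite [RHS]mxE.
by rewrite !map_mxM map_mx_adj evU !ev.
Qed.

Section DetInIdeal.

Variables (R : comNzRingType) (K : R -> Prop).
Hypotheses (K0 : K 0) (KD : forall x y, K x -> K y -> K (x + y))
           (KM : forall a x, K x -> K (a * x)).

(** Laplace expansion, first along the rows of [Rb], then along the columns of [Cb], then along any
    row until size [t] is reached. The bound ensures that the forbidden rows and columns run out in
    time. *)
Lemma det_in_ideal t p (M : 'M[R]_p) (Rb Cb : {set 'I_p}) :
    (t + #|Rb| + #|Cb| <= p)%N ->
    (forall (rho gam : 'I_t -> 'I_p), (forall i, rho i \notin Rb) ->
       (forall j, gam j \notin Cb) -> K (\det (mxsub rho gam M))) ->
  K (\det M).
Proof.
have Ksum (I : finType) (F : I -> R) : (forall i, K (F i)) -> K (\sum_i F i).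
  by move=> KF; elim/big_ind: _.
elim: p => [|p IHp] in M Rb Cb *.
  rewrite leqn0 !addn_eq0 -andbA => /and3P[/eqP t0 _ _]; subst t.
  by move=> /(_ id id); rewrite !det_mx00; apply; case.
have row_case (N : 'M[R]_p.+1) (Rb' Cb' : {set 'I_p.+1}) i :
    (t + #|Rb' :\ i| + #|Cb'| <= p)%N ->
    (forall (rho gam : 'I_t -> 'I_p.+1), (forall i, rho i \notin Rb') ->
       (forall j, gam j \notin Cb') -> K (\det (mxsub rho gam N))) ->
    K (\det N).
  move=> le_p Kmin; rewrite (expand_det_row N i); apply: Ksum => j.
  apply: KM; rewrite /cofactor; apply: KM.
  apply: (IHp _ (lift i @^-1: Rb') (lift j @^-1: Cb')) => [|rho gam rhoP gamP].
    apply: leq_trans le_p; rewrite -addnA -addnA leq_add2l; apply: leq_add.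
      rewrite -(card_imset _ (@lift_inj _ i)); apply/subset_leq_card/subsetP.
      move=> _ /imsetP[x xR ->]; rewrite !inE in xR *.
      by rewrite xR andbT eq_sym neq_lift.
    rewrite -(card_imset _ (@lift_inj _ j)); apply/subset_leq_card/subsetP.
    by move=> _ /imsetP[x xC ->]; rewrite !inE in xC *.
  have -> : mxsub rho gam (row' i (col' j N))
            = mxsub (lift i \o rho) (lift j \o gam) N.
    by apply/matrixP=> x y; rewrite !mxE.
  apply: Kmin => x /=.
    by have := rhoP x; rewrite inE.
  by have := gamP x; rewrite inE.
move=> le_p Kmin.
have [Rb0|[i iR]] := set_0Vmem Rb; last first.
  apply: (row_case M Rb Cb i) Kmin.
  by move: le_p; rewrite (cardsD1 i Rb) iR; lia.
have [Cb0|[j jC]] := set_0Vmem Cb; last first.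
  rewrite -det_tr; apply: (row_case M^T Cb Rb j).
    by move: le_p; rewrite (cardsD1 j Cb) jC; lia.
  move=> rho gam rhoP gamP; rewrite -det_tr.
  have -> : (mxsub rho gam M^T)^T = mxsub gam rho M.
    by apply/matrixP=> x y; rewrite !mxE.
  exact: Kmin.
move: le_p; rewrite Rb0 Cb0 cards0 !addn0 leq_eqVlt => /predU1P[tp|lt_tp].
  subst t; have := Kmin id id.
  rewrite (_ : mxsub id id M = M); last by apply/matrixP=> x y; rewrite !mxE.
  by apply=> x; rewrite ?Rb0 ?Cb0 inE.
apply: (row_case M Rb Cb ord0) Kmin.
by rewrite Rb0 Cb0 set0D cards0 !addn0.
Qed.

End DetInIdeal.

(** Expanding along a unit row outside the image of [ka] deletes its diagonal position. Once [ka] is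
    onto, rows and columns undergo the same permutation and the two signs cancel. *)
Lemma det_unit_rows (R : comNzRingType) p d (M : 'M[R]_d) (ka : 'I_p -> 'I_d) :
    injective ka ->
    (forall i j, i \notin codom ka -> M i j = (i == j)%:R) ->
  \det M = \det (mxsub ka ka M).
Proof.
elim: d => [|d IHd] in M ka *.
  move=> ka_inj _; case: p ka ka_inj => [|p] ka; first by rewrite !det_mx00.
  by case: (ka ord0).
move=> ka_inj Munit.
have [i iN|kaT] := pickP [pred i | i \notin codom ka].
  rewrite /= in iN.
  rewrite (expand_det_row M i) (bigD1 i) //= big1 ?addr0; last first.
    by move=> j ji; rewrite Munit // eq_sym (negPf ji) mul0r.
  rewrite Munit // eqxx mul1r /cofactor -signr_odd oddD addbb expr0 mul1r.
  have lka x : exists y, ka x = lift i y.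
    have: i != ka x by apply: contraNneq iN => ->; rewrite codom_f.
    by case/unlift_some=> y -> _; exists y.
  have [ka' ka'E] := fin_all_exists lka.
  rewrite (IHd _ ka') => [|x y|x y xN].
  - by congr (\det _); apply/matrixP=> x y; rewrite !mxE !ka'E.
  - by move=> xy; apply: ka_inj; rewrite !ka'E xy.
  - rewrite !mxE Munit ?(inj_eq lift_inj) //.
    apply: contra xN => /codomP[z]; rewrite ka'E => /lift_inj ->.
    exact: codom_f.
have p_d : p = d.+1.
  have := card_codom ka_inj; rewrite card_ord => <-.
  rewrite -[RHS]card_ord; apply: eq_card => i.
  by have /negbFE := kaT i.
subst p; rewrite (_ : mxsub ka ka M = row_perm (perm ka_inj) (col_perm (perm ka_inj) M)).
  rewrite row_permE col_permE !det_mulmx !det_perm mulrC -mulrA odd_permV.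
  by rewrite -signr_addb addbb mulr1.
by apply/matrixP=> i j; rewrite !mxE !permE.
Qed.

(** * Ideals and term orders *)

Section IdealGen.

Variables (k : fieldType) (N : nat) (G : {mpoly k[N]} -> Prop).
Implicit Types (p q : {mpoly k[N]}).

Lemma ideal_gen0 : ideal_gen G 0.
Proof. by exists [::]; rewrite ?big_nil. Qed.

Lemma ideal_genD p q : ideal_gen G p -> ideal_gen G q -> ideal_gen G (p + q).
Proof.
move=> [s sG ->] [s' sG' ->]; exists (s ++ s'); last by rewrite big_cat.
by move=> x; rewrite mem_cat => /orP[/sG|/sG'].
Qed.

Lemma ideal_genM a p : ideal_gen G p -> ideal_gen G (a * p).
Proof.
move=> [s sG ->]; exists [seq (a * x.1, x.2) | x <- s].
  by move=> _ /mapP[x /sG xG ->].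
by rewrite big_map mulr_sumr; apply: eq_bigr => x _; rewrite mulrA.
Qed.

Lemma ideal_gen_mem p : G p -> ideal_gen G p.
Proof.
move=> Gp; exists [:: (1, p)]; last by rewrite big_seq1 mul1r.
by move=> x; rewrite inE => /eqP->.
Qed.

Lemma ideal_gen_ind (K : {mpoly k[N]} -> Prop) :
    K 0 -> (forall p q, K p -> K q -> K (p + q)) ->
    (forall a p, K p -> K (a * p)) -> (forall p, G p -> K p) ->
  forall p, ideal_gen G p -> K p.
Proof.
move=> K0 KD KM KG p [s sG ->]; rewrite big_seq.
by elim/big_ind: _ => // x xs; apply/KM/KG/sG.
Qed.

End IdealGen.

Section TermOrder.

Variables (k : fieldType) (N : nat) (le : rel 'X_{1..N}).
Hypothesis hle : term_order le.
Implicit Types (p q r : {mpoly k[N]}) (m : 'X_{1..N}).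

Let le_anti : antisymmetric le. Proof. by case: hle. Qed.
Let le_trans : transitive le. Proof. by case: hle. Qed.
Let le_total : total le. Proof. by case: hle. Qed.
Let le0 m : le 0%MM m. Proof. by case: hle. Qed.

Lemma term_le_add m m1 m2 : le (m1 + m)%MM (m2 + m)%MM = le m1 m2.
Proof.
have mono : forall x y z, le x y -> le (x + z)%MM (y + z)%MM.
  by case: hle => _ _ _ _ h x y z; apply: h.
apply/idP/idP=> [le12|]; last exact: mono.
case/orP: (le_total m1 m2) => // /(mono _ _ m) le21.
have /eqP: (m1 + m)%MM = (m2 + m)%MM by apply: le_anti; rewrite le12.
rewrite eqm_add2r => /eqP ->.
by have := le_total m2 m2; rewrite orbb.
Qed.

Lemma init_monP p : p != 0 ->
  init_mon le p \in msupp p /\ forall m, m \in msupp p -> le m (init_mon le p).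
Proof.
rewrite -msupp_eq0 /init_mon; elim: (msupp p) => // m s IHs _ /=.
case: s IHs => [_|m' s /(_ isT) [IHin IHmax]].
  rewrite [foldr _ _ _]/=; case: ifP => [m_le0|_].
    have -> : m = 0%MM by apply: le_anti; rewrite m_le0 le0.
    by split=> [|m']; rewrite inE // => /eqP->.
  split=> [|m']; rewrite inE // => /eqP->.
  by have := le_total m m; rewrite orbb.
set r := foldr _ _ _ in IHin IHmax *; case: ifPn => [m_le|Nm_le].
  by split=> [|x]; rewrite inE ?IHin ?orbT // => /predU1P[->|/IHmax].
have r_le : le r m by have := le_total r m; rewrite (negPf Nm_le) orbF.
split=> [|x]; rewrite inE ?eqxx // => /predU1P[->|/IHmax xr].
  by have := le_total m m; rewrite orbb.
exact: le_trans r_le.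
Qed.

Lemma init_mon_eq p m : m \in msupp p ->
  (forall m', m' \in msupp p -> le m' m) -> init_mon le p = m.
Proof.
move=> mp max_m.
have p0 : p != 0 by rewrite -msupp_eq0; case: (msupp p) mp.
have [ip max_i] := init_monP p0.
by apply: le_anti; rewrite max_m ?max_i.
Qed.

Lemma init_monZ c p : c != 0 -> init_mon le (c *: p) = init_mon le p.
Proof.
move=> c0; have [->|p0] := eqVneq p 0; first by rewrite scaler0.
have [ip max_i] := init_monP p0.
apply: init_mon_eq => [|m]; rewrite (perm_mem (msuppZ _ c0)) //.
exact: max_i.
Qed.

Lemma init_monN p : init_mon le (- p) = init_mon le p.
Proof. by rewrite -scaleN1r init_monZ // oppr_eq0 oner_eq0. Qed.

Lemma init_monX m : init_mon le 'X_[k, m] = m.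
Proof.
apply: init_mon_eq => [|m']; rewrite msuppX mem_seq1 // => /eqP->.
by have := le_total m m; rewrite orbb.
Qed.

Lemma init_monB p q : p != 0 -> q != 0 -> init_mon le p != init_mon le q ->
    le (init_mon le q) (init_mon le p) ->
  p - q != 0 /\ init_mon le (p - q) = init_mon le p.
Proof.
move=> p0 q0 npq le_qp; have [pP pmax] := init_monP p0.
have [_ qmax] := init_monP q0.
have iN : init_mon le p \notin msupp q.
  by apply: contra npq => /qmax ?; apply/eqP/le_anti/andP.
have iP : init_mon le p \in msupp (p - q).
  by rewrite mcoeff_msupp mcoeffB (memN_msupp_eq0 iN) subr0 -mcoeff_msupp.
split; first by rewrite -msupp_eq0; case: (msupp _) iP.
apply: init_mon_eq => // m /msuppB_le; rewrite mem_cat => /orP[/pmax //|].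
by move/qmax/le_trans; apply.
Qed.

Lemma init_monM p q : p != 0 -> q != 0 ->
  p * q != 0 /\ init_mon le (p * q) = (init_mon le p + init_mon le q)%MM.
Proof.
move=> p0 q0; split; first by rewrite mulf_neq0.
have [pP pmax] := init_monP p0; have [qP qmax] := init_monP q0.
have le2 m1 m2 : m1 \in msupp p -> m2 \in msupp q ->
    le (m1 + m2)%MM (init_mon le p + init_mon le q)%MM.
  move=> /pmax m1P /qmax m2P.
  apply: (@le_trans (init_mon le p + m2)%MM); first by rewrite term_le_add.
  by rewrite addmC [X in le _ X]addmC term_le_add.
apply: init_mon_eq => [|m /msuppM_le /allpairsP[[m1 m2] [/= m1P m2P ->]]];
  last exact: le2.
rewrite mcoeff_msupp mpolyME big_allpairs raddf_sum /=.
rewrite (bigD1_seq (init_mon le p)) //= raddf_sum /= (bigD1_seq (init_mon le q)) //=.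
rewrite mcoeffZ mcoeffX eqxx mulr1 big1_seq ?addr0; last first.
  move=> m2 /andP[m2i m2P]; rewrite mcoeffZ mcoeffX eqm_add2l (negPf m2i).
  by rewrite mulr0.
rewrite big1_seq ?addr0 -?mcoeff_msupp.
  by rewrite mulf_neq0 -?mcoeff_msupp.
move=> m1 /andP[m1i m1P]; rewrite raddf_sum big1_seq //= => m2 m2P.
rewrite mcoeffZ mcoeffX; case: eqP => [e|_]; last by rewrite mulr0.
case/eqP: m1i; apply: le_anti; rewrite pmax //=.
rewrite -(term_le_add m2) e.
by rewrite addmC [X in le _ X]addmC term_le_add qmax.
Qed.

(** Division of initial terms only. The degree bound [D] stands in for well-foundedness: the
    reducers are homogeneous, so the support stays in the finite set of monomials of degree below
    [D], and fewer and fewer of these lie below the initial monomial. *)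
Lemma init_reduce D (K : {mpoly k[N]} -> Prop) (J : 'X_{1..N} -> Prop) :
    K 0 -> (forall p q, K p -> K q -> K (p + q)) ->
    (forall a p, K p -> K (a * p)) ->
    (forall m, J m -> exists2 r, K r & [/\ r != 0, init_mon le r = m
       & forall m', m' \in msupp r -> mdeg m' = mdeg m]) ->
  forall q, (forall m, m \in msupp q -> mdeg m < D)%N ->
  exists2 q', K (q - q') & q' = 0 \/ ~ J (init_mon le q').
Proof.
move=> K0 KD KM Jred q.
pose below q' := [set b : 'X_{1..N < D} | le b (init_mon le q')].
have [n] := ubnP #|below q|; elim: n q => // n IHn q ltn degq.
have [->|q0] := eqVneq q 0; first by exists 0; [rewrite subr0 | left].
case: (classic (J (init_mon le q))) => [Jq|]; last first.
  by move=> NJ; exists q; [rewrite subrr | right].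
have [r Kr [r0 ir degr]] := Jred _ Jq.
have [iq maxq] := init_monP q0; have [irP maxr] := init_monP r0.
pose c := q@_(init_mon le q) / r@_(init_mon le r).
have c0 : c != 0 by rewrite mulf_neq0 ?invr_eq0 -?mcoeff_msupp.
have suppq1 m : m \in msupp (q - c *: r) -> m \in msupp q \/ m \in msupp r.
  move/msuppB_le; rewrite mem_cat => /orP[|/msuppZ_le]; by [left|right].
have [q10|q10] := eqVneq (q - c *: r) 0.
  exists 0; last by left.
  by rewrite subr0 -(subrK (c *: r) q) q10 add0r -mul_mpolyC; apply: KM.
have [i1 max1] := init_monP q10.
have lt_q1 : le (init_mon le (q - c *: r)) (init_mon le q).
  by case: (suppq1 _ i1) => [/maxq //|/maxr]; rewrite ir.
have ne_q1 : init_mon le (q - c *: r) != init_mon le q.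
  apply: contraTneq i1 => ->.
  rewrite mcoeff_msupp negbK mcoeffB mcoeffZ /c ir divfK ?subrr //.
  by rewrite -mcoeff_msupp -ir.
have [||q' Kq' q'P] := IHn (q - c *: r).
- rewrite ltnS in ltn; apply: leq_trans ltn; apply/proper_card/properP.
  split; first by apply/subsetP=> b; rewrite !inE => /le_trans; apply.
  exists (BMultinom (degq _ iq)); rewrite !inE /=.
    by have := le_total (init_mon le q) (init_mon le q); rewrite orbb.
  apply: contra ne_q1 => le_q; apply/eqP/le_anti; rewrite lt_q1; exact: le_q.
- move=> m /suppq1[/degq //|/degr ->]; exact: degq.
exists q' => //; rewrite (_ : q - q' = q - c *: r - q' + c%:MP * r).
  by apply: KD => //; apply: KM.
by rewrite mul_mpolyC addrAC subrK.
Qed.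

End TermOrder.

(** * Chains of cells *)

Definition lt2 (x y : nat * nat) : bool := (x.1 < y.1)%N && (x.2 < y.2)%N.

Definition in_rect (A B : nat) (x : nat * nat) : bool :=
  (x.1 < A)%N && (x.2 < B)%N.

Lemma lt2_trans : transitive lt2.
Proof. by move=> y x z /andP[? ?] /andP[? ?]; apply/andP; split; lia. Qed.

Lemma in_rect_sub A B A' B' x :
  (A <= A')%N -> (B <= B')%N -> in_rect A B x -> in_rect A' B' x.
Proof. by move=> ? ? /andP[? ?]; apply/andP; split; lia. Qed.

Lemma chain_cat s1 x s2 :
  sorted lt2 (s1 ++ x :: s2) =
  [&& sorted lt2 s1, all (lt2^~ x) s1, all (lt2 x) s2 & sorted lt2 s2].
Proof.
have tr := lt2_trans; rewrite !sorted_pairwise // pairwise_cat allrel_consr /=.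
apply/and4P/and4P=> [[/andP[-> _] -> -> ->] //|[p1 h1 h2 ->]].
rewrite h1 p1 h2; split=> //=; apply/allrelP=> y z yP zP.
exact: (tr x _ _ (allP h1 _ yP) (allP h2 _ zP)).
Qed.

Lemma chain_gap s e j : sorted lt2 s -> (e + j < size s)%N ->
  ((nth (0, 0) s e).1 + j <= (nth (0, 0) s (e + j)).1)%N /\
  ((nth (0, 0) s e).2 + j <= (nth (0, 0) s (e + j)).2)%N.
Proof.
move=> sort_s; elim: j => [|j IHj] lt_j; first by rewrite !addn0.
have [|h1 h2] := IHj; first by lia.
rewrite addnS in lt_j *.
have /andP[] := sortedP (0, 0)%N sort_s (e + j)%N lt_j.
by lia.
Qed.

Lemma chain_size1 s lo hi : sorted lt2 s ->
  all (fun x => lo <= x.1 < hi)%N s -> (size s <= hi - lo)%N.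
Proof.
case: s => // x s sort_s sP; set s' := x :: s in sort_s sP *.
have lt_s : (0 + size s < size s')%N by [].
have [h _] := chain_gap sort_s lt_s.
have /andP[h1 _] : (lo <= (nth (0, 0) s' 0).1 < hi)%N by apply/(allP sP)/mem_nth.
have /andP[_ h2] : (lo <= (nth (0, 0) s' (0 + size s)).1 < hi)%N.
  by apply/(allP sP)/mem_nth.
by rewrite /=; lia.
Qed.

Lemma chain_size2 s lo hi : sorted lt2 s ->
  all (fun x => lo <= x.2 < hi)%N s -> (size s <= hi - lo)%N.
Proof.
case: s => // x s sort_s sP; set s' := x :: s in sort_s sP *.
have lt_s : (0 + size s < size s')%N by [].
have [_ h] := chain_gap sort_s lt_s.
have /andP[h1 _] : (lo <= (nth (0, 0) s' 0).2 < hi)%N by apply/(allP sP)/mem_nth.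
have /andP[_ h2] : (lo <= (nth (0, 0) s' (0 + size s)).2 < hi)%N.
  by apply/(allP sP)/mem_nth.
by rewrite /=; lia.
Qed.

Lemma split_last_has (p : pred (nat * nat)) (s : seq (nat * nat)) : has p s ->
  exists s1 x s2, [/\ s = s1 ++ x :: s2, p x & all (predC p) s2].
Proof.
elim: s => //= y s IHs; case: (boolP (has p s)) => [/IHs[s1 [x [s2 [-> px ps]]]] _|].
  by exists (y :: s1), x, s2.
by rewrite -all_predC => ps; rewrite orbF => py; exists [::], y, s.
Qed.

(** When [S] is the support of a monomial, the monomial is divisible by the diagonal of some
    [t]-minor on the first [A] rows and [B] columns. *)
Definition has_chain (S : pred (nat * nat)) A B t : Prop :=
  exists s, [/\ sorted lt2 s, (t <= size s)%N, all (in_rect A B) s & all S s].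

Lemma has_chain_sub (S S' : pred (nat * nat)) A B t A' B' t' :
    (A <= A')%N -> (B <= B')%N -> (t' <= t)%N ->
    (forall x, in_rect A B x -> S x -> S' x) ->
  has_chain S A B t -> has_chain S' A' B' t'.
Proof.
move=> leA leB let' SS' [s [sort_s ts sR sS]]; exists s; split=> //.
- exact: leq_trans ts.
- by apply: sub_all sR => x; apply: in_rect_sub.
- by apply/allP=> x xs; apply: SS'; [apply: (allP sR) | apply: (allP sS)].
Qed.

(** The last conjunct says that [a] cannot be raised. Induction on [M], starting from [0], where no
    cell is available. *)
Lemma max_below (S : pred (nat * nat)) y l M : exists a, [/\ (a <= M)%N,
    ~ has_chain S a y l.+1 & a = M \/ has_chain S a.+1 y l.+1].
Proof.
elim: M => [|M [a [aM nbelow]]].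
  exists 0%N; split=> //; last by left.
  by case=> -[|x s] [] //= _ _ /andP[].
case=> [aE|]; last by exists a; split; [lia| |right].
subst a; case: (classic (has_chain S M.+1 y l.+1)) => h.
  by exists M; split; [lia| |right].
by exists M.+1; split=> //; left.
Qed.

(* The l-th cell of the new chain g is placed in column B - t - 1 + l, as far
   from the origin as is possible while the chains of S strictly below it have at
   most l cells. One row further there is such a chain of l + 1 cells, which can
   replace the part up to that cell of any chain running through it. *)
Lemma chain_extension (S : pred (nat * nat)) (cs : seq (nat * nat * nat)) A B t :
    (t < A)%N -> (t < B)%N ->
    (forall c : nat * nat * nat, c \in cs ->
       (c.1.1 + t.+1 < c.2 + A)%N || (c.1.2 + t.+1 < c.2 + B)%N) ->
    (forall c : nat * nat * nat, c \in cs -> ~ has_chain S c.1.1 c.1.2 c.2) ->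
  exists g, [/\ sorted lt2 g, size g = t, all (in_rect A.-1 B.-1) g
    & forall c : nat * nat * nat, c \in cs ->
        ~ has_chain [pred x | S x || (x \in g)] c.1.1 c.1.2 c.2].
Proof.
move=> tA tB csP NS.
pose y l := (B - t.+1 + l)%N; pose M l := (A - t.+1 + l)%N.
have [a aP] := fin_all_exists (fun l : 'I_t => max_below S (y l) l (M l)).
pose g := [seq (a l, y l) | l <- enum 'I_t].
have gP x : x \in g -> exists l : 'I_t, x = (a l, y l).
  by case/mapP=> l _ ->; exists l.
(* Otherwise [a j] is below its cap [M j], so a chain of [j.+1] cells blocks it. Each step of that
   chain moves at least one row and one column, hence its first [i.+1] cells would fit in [a i] rows
   and [y i] columns. *)
have a_incr (i j : 'I_t) : (i < j)%N -> (a i < a j)%N.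
  move=> ij; rewrite ltnNge; apply/negP=> le_ji.
  have [aMi nbi _] := aP i; have [_ _ [ajE|[s [sort_s js sR sS]]]] := aP j.
    by rewrite /M in aMi ajE; lia.
  apply: nbi; exists (take i.+1 s); split.
  - exact: take_sorted.
  - by rewrite size_take; case: ifP; lia.
  - apply/(all_nthP (0, 0)%N)=> e; rewrite size_take => e_lt.
    have e_i : (e < i.+1)%N by move: e_lt; case: ifP; lia.
    rewrite nth_take //.
    have lt1 : (e + (j - e) < size s)%N by lia.
    have [h1 h2] := chain_gap sort_s lt1.
    have /andP[] := all_nthP (0, 0)%N sR _ lt1.
    by rewrite /in_rect /y; lia.
  - by apply/allP=> x /mem_take; apply: (allP sS).
have y_lt (l : 'I_t) : (y l < B.-1)%N by rewrite /y; have := ltn_ord l; lia.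
have a_lt (l : 'I_t) : (a l < A.-1)%N.
  by have [] := aP l; rewrite /M; have := ltn_ord l; lia.
(* Cut such a chain at its last cell of [g], of index [l']. Induction bounds the part before it by
   [l'], and the part after it fits in the [l - l' - 1] columns in between. *)
have size_below (l : 'I_t) s : sorted lt2 s -> all (lt2^~ (a l, y l)) s ->
    all [pred x | S x || (x \in g)] s -> (size s <= l)%N.
  have [n] := ubnP (val l); elim: n l s => // n IHn l s.
  rewrite ltnS => l_n sort_s s_l sSg.
  case: (boolP (has (mem g) s)) => [|]; last first.
    rewrite -all_predC => sNg; have [_ nb _] := aP l.
    rewrite leqNgt; apply/negP=> l_s; apply: nb; exists s; split=> //.
    apply/allP=> x xs; have := allP sSg _ xs; have /negPf /= -> := allP sNg _ xs.
    by rewrite orbF.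
  case/split_last_has=> s1 [x [s2 [sE xg _]]]; subst s.
  have [l' xE] := gP _ xg; subst x.
  move: sort_s s_l sSg; rewrite chain_cat !all_cat /=.
  case/and4P=> sort1 lt1 lt2' sort2 /and3P[_ /andP[_ /= y_lt'] s2_l] /andP[sSg1 _].
  have l'_l : (l' < l)%N by rewrite /y in y_lt'; lia.
  have := IHn l' s1 (leq_trans l'_l l_n) sort1 lt1 sSg1.
  have : (size s2 <= y l - (y l').+1)%N.
    apply: chain_size2 => //; apply/allP=> z zs.
    by have /andP[_ ->] := allP lt2' _ zs; have /andP[] := allP s2_l _ zs.
  by rewrite size_cat /= /y; lia.
exists g; split.
- have: sorted (relpre val ltn) (enum 'I_t).
    by rewrite -sorted_map val_enum_ord iota_ltn_sorted.
  apply: homo_sorted => i j /= ij; rewrite /lt2 /= a_incr //= /y.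
  by rewrite ltn_add2l.
- by rewrite size_map size_enum_ord.
- by apply/allP=> _ /gP[l ->]; rewrite /in_rect /= a_lt y_lt.
move=> c cc [s [sort_s cs' sR sSg]].
case: (boolP (has (mem g) s)) => [|]; last first.
  rewrite -all_predC => sNg; apply: (NS c cc); exists s; split=> //.
  apply/allP=> x xs; have := allP sSg _ xs; have /negPf /= -> := allP sNg _ xs.
  by rewrite orbF.
case/split_last_has=> s1 [x [s2 [sE xg s2Ng]]]; subst s.
have [l xE] := gP _ xg; subst x.
move: sort_s sR sSg cs'; rewrite chain_cat !all_cat size_cat /=.
case/and4P=> sort1 lt1 lt2' sort2 /and3P[sR1 /andP[/= aA yB] sR2].
case/andP=> sSg1 /andP[_ sSg2] c_s.
have size1 := size_below l s1 sort1 lt1 sSg1.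
have sS2 : all S s2.
  apply/allP=> x xs; have := allP sSg2 _ xs; have /negPf /= -> := allP s2Ng _ xs.
  by rewrite orbF.
(* If [a l] is at its cap, at most [l] cells come before, and the remaining rows or columns bound
   those after, against [csP]. Otherwise the blocking chain [s0] is spliced in front of [s2]. *)
have [_ _ [aE|[s0 [sort0 l_s0 sR0 sS0]]]] := aP l.
  have h1 : (size s2 <= c.1.1 - (a l).+1)%N.
    apply: chain_size1 => //; apply/allP=> z zs.
    by have /andP[-> _] := allP lt2' _ zs; have /andP[] := allP sR2 _ zs.
  have h2 : (size s2 <= c.1.2 - (y l).+1)%N.
    apply: chain_size2 => //; apply/allP=> z zs.
    by have /andP[_ ->] := allP lt2' _ zs; have /andP[] := allP sR2 _ zs.
  rewrite /M /y in aE h2 yB; have lt := ltn_ord l; case/orP: (csP c cc) => hc.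
    by clear -c_s size1 aE h1 aA lt hc tA; lia.
  by clear -c_s size1 h2 yB lt hc tB; lia.
apply: (NS c cc); exists (s0 ++ s2); split.
- rewrite sorted_pairwise ?pairwise_cat -?sorted_pairwise //; try exact: lt2_trans.
  rewrite sort0 sort2 !andbT; apply/allrelP=> z1 z2 /(allP sR0) /andP[r1 c1].
  move=> /(allP lt2') /andP[/= r2 c2].
  by rewrite /lt2 (leq_trans r1 r2) (ltn_trans c1 c2).
- by rewrite size_cat; clear -c_s size1 l_s0; lia.
- rewrite all_cat sR2 andbT; apply: sub_all sR0 => z.
  by apply: in_rect_sub => //; apply: ltnW.
- by rewrite all_cat sS0.
Qed.

(** * Minors of a matrix of indeterminates *)

(** The two terms in [x] cancel on the left, and the two copies of [a' *m W' *m V *m W *m b] cancel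
    on the right. *)
Lemma exchange_identity (R : comNzRingType) t (W W' V : 'M[R]_t) (a a' : 'rV[R]_t)
    (b b' : 'cV[R]_t) (x y y' : R) :
  y * (x * y' - (a' *m W' *m b') 0 0) - (x * y - (a *m W *m b) 0 0) * y'
  = ((y' *: a - a' *m W' *m V) *m (W *m b)) 0 0
    - (a' *m W' *m (y *: b' - V *m W *m b)) 0 0.
Proof.
rewrite mulmxBl mulmxBr -scalemxAl -scalemxAr !mulmxA.
set p := (_ *m b'); set q := a *m W *m b; set r := _ *m b.
have E (A B : 'M[R]_1) c : (c *: A - B) 0 0 = c * A 0 0 - B 0 0 by rewrite !mxE.
rewrite !E. ring.
Qed.

Definition extend0 t (h : 'I_t -> nat) (i : nat) : nat := oapp h 0%N (insub i).

Lemma extend0E t (h : 'I_t -> nat) (i : 'I_t) : extend0 h i = h i.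
Proof. by rewrite /extend0 valK. Qed.

Lemma extend0_bound t (h : 'I_t -> nat) A : (forall i, h i < A)%N ->
  forall i, (i < t)%N -> (extend0 h i < A)%N.
Proof. by move=> hA i it; rewrite -[i]/(val (Ordinal it)) extend0E. Qed.

Section Minors.

Variables (k : fieldType) (N : nat) (u : nat * nat -> 'X_{1..N}).

(** Rows and columns are selected by functions on [nat], repetitions allowed, so that one selection
    serves minors of several sizes. *)
Definition gmx m n (rho gam : nat -> nat) : 'M[{mpoly k[N]}]_(m, n) :=
  \matrix_(i < m, j < n) 'X_[u (rho i, gam j)].

Definition minor t rho gam : {mpoly k[N]} := \det (gmx t t rho gam).

Definition chain_minor s : {mpoly k[N]} :=
  minor (size s) (fun i => (nth (0, 0)%N s i).1) (fun i => (nth (0, 0)%N s i).2).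

Lemma eq_minor t rho rho' gam gam' :
    (forall i, i < t -> rho i = rho' i)%N ->
    (forall i, i < t -> gam i = gam' i)%N ->
  minor t rho gam = minor t rho' gam'.
Proof.
move=> eq_r eq_g; congr (\det _); apply/matrixP=> i j.
by rewrite !mxE eq_r ?eq_g.
Qed.

Lemma minor_row_eq0 t rho gam i j :
  (i < t)%N -> (j < t)%N -> i != j -> rho i = rho j -> minor t rho gam = 0.
Proof.
move=> it jt ij rij.
apply: (@determinant_alternate _ _ _ (Ordinal it) (Ordinal jt)) => // l.
by rewrite !mxE /= rij.
Qed.

Lemma minor_col_eq0 t rho gam i j :
  (i < t)%N -> (j < t)%N -> i != j -> gam i = gam j -> minor t rho gam = 0.
Proof.
move=> it jt ij gij; rewrite /minor -det_tr.
apply: (@determinant_alternate _ _ _ (Ordinal it) (Ordinal jt)) => // l.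
by rewrite !mxE /= gij.
Qed.

Definition swap (f : nat -> nat) i j l :=
  if l == i then f j else if l == j then f i else f l.

Lemma minor_row_swap t rho gam i j : (i < t)%N -> (j < t)%N ->
  exists e, minor t rho gam = e * minor t (swap rho i j) gam.
Proof.
move=> it jt; pose s := tperm (Ordinal it) (Ordinal jt).
exists ((-1) ^+ s); rewrite /minor.
have <- : row_perm s (gmx t t rho gam) = gmx t t (swap rho i j) gam.
  apply/matrixP=> a b; rewrite !mxE /swap /s.
  case: tpermP => [->|->|/eqP ai /eqP aj] /=; rewrite ?eqxx //.
    by case: eqP => // ->.
  by rewrite -!val_eqE /= in ai aj; rewrite (negPf ai) (negPf aj).
by rewrite row_permE det_mulmx det_perm mulrA -signr_addb addbb mul1r.
Qed.

Lemma minor_col_swap t rho gam i j : (i < t)%N -> (j < t)%N ->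
  exists e, minor t rho gam = e * minor t rho (swap gam i j).
Proof.
move=> it jt; pose s := tperm (Ordinal it) (Ordinal jt).
exists ((-1) ^+ s); rewrite /minor.
have <- : col_perm s (gmx t t rho gam) = gmx t t rho (swap gam i j).
  apply/matrixP=> a b; rewrite !mxE /swap /s.
  case: tpermP => [->|->|/eqP ai /eqP aj] /=; rewrite ?eqxx //.
    by case: eqP => // ->.
  by rewrite -!val_eqE /= in ai aj; rewrite (negPf ai) (negPf aj).
rewrite col_permE det_mulmx det_perm mulrC -mulrA odd_permV -signr_addb.
by rewrite addbb mulr1.
Qed.

Definition ext (f : nat -> nat) t x i := if (i < t)%N then f i else x.

Lemma ext_lt f t x i : (i < t)%N -> ext f t x i = f i.
Proof. by rewrite /ext => ->. Qed.

Lemma ext_eq f t x : ext f t x t = x.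
Proof. by rewrite /ext ltnn. Qed.

Lemma minor_ext t rho gam r c :
  minor t.+1 (ext rho t r) (ext gam t c) = 'X_[u (r, c)] * minor t rho gam
   - (gmx 1 t (fun=> r) gam *m \adj (gmx t t rho gam)
      *m gmx t 1 rho (fun=> c)) 0 0.
Proof.
rewrite -[t.+1]addn1 /minor.
have -> : gmx (t + 1) (t + 1) (ext rho t r) (ext gam t c) =
    block_mx (gmx t t rho gam) (gmx t 1 rho (fun=> c))
             (gmx 1 t (fun=> r) gam) (gmx 1 1 (fun=> r) (fun=> c)).
  apply/matrixP=> i j; rewrite mxE.
  case: (split_ordP i) => i' ->; case: (split_ordP j) => j' ->;
    rewrite ?block_mxEul ?block_mxEur ?block_mxEdl ?block_mxEdr mxE
      ?(ord1 i') ?(ord1 j') /= ?addn0 ?ext_eq ?ext_lt //.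
rewrite det_bordered; congr (_ * _ - _).
by rewrite mxE.
Qed.

(** Each term of the Leibniz formula is, up to sign, a product of [t] indeterminates. This is the
    homogeneity that [init_reduce] asks for. *)
Lemma minor_mdeg t rho gam :
    (forall i j, i < t -> j < t -> mdeg (u (rho i, gam j)) = 1)%N ->
  forall m, m \in msupp (minor t rho gam) -> mdeg m = t.
Proof.
move=> deg1; rewrite /minor /determinant.
elim/big_ind: _ => [m|p q IHp IHq m|s _ m]; first by rewrite msupp0.
  by move/msuppD_le; rewrite mem_cat => /orP[/IHp|/IHq].
rewrite (eq_bigr (fun i : 'I_t => 'X_[u (rho i, gam (s i))])); last first.
  by move=> i _; rewrite mxE.
rewrite -(big_map (fun i => u (rho (val i), gam (val (s i)))) xpredT
           (fun m => 'X_[k, m])) mpolyX_prod big_map.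
have -> : (m \in msupp ((-1) ^+ s * 'X_[k, \sum_i u (rho (val i), gam (val (s i)))]))
          = (m == \sum_i u (rho (val i), gam (val (s i))))%MM.
  rewrite mulr_sign; case: ifP => _; last by rewrite msuppX mem_seq1.
  by rewrite (perm_mem (msuppN _)) msuppX mem_seq1.
move/eqP->; rewrite mdeg_sum (eq_bigr (fun=> 1%N)) => [|i _]; last first.
  exact: deg1 (ltn_ord i) (ltn_ord (s i)).
by rewrite sum_nat_const card_ord muln1.
Qed.

(* Write the two minors through (A, B) as x det U - a adj(U) b and
   x det U' - a' adj(U') b', and let V have the rows of U' and the columns of U.
   Modulo K, Cramer's rule gives b' det U = V adj(U) b and
   a det U' = a' adj(U') V, so both a adj(U) b det U' and a' adj(U') b' det U
   equal a' adj(U') V adj(U) b. *)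
Lemma minor_exchange (K : {mpoly k[N]} -> Prop) t rho gam rho' gam' A B :
    K 0 -> (forall p q, K p -> K q -> K (p + q)) ->
    (forall a p, K p -> K (a * p)) ->
    (forall i, (i < t)%N ->
       K (minor t.+1 (ext rho t (rho' i)) (ext gam t B))) ->
    (forall j, (j < t)%N ->
       K (minor t.+1 (ext rho' t A) (ext gam' t (gam j)))) ->
  K (minor t rho gam * minor t.+1 (ext rho' t A) (ext gam' t B)
     - minor t.+1 (ext rho t A) (ext gam t B) * minor t rho' gam').
Proof.
move=> K0 KD KM Kb Ka.
pose U := gmx t t rho gam; pose U' := gmx t t rho' gam'.
pose V := gmx t t rho' gam.
pose a := gmx 1 t (fun=> A) gam; pose a' := gmx 1 t (fun=> A) gam'.
pose b := gmx t 1 rho (fun=> B); pose b' := gmx t 1 rho' (fun=> B).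
pose e := \det U *: b' - V *m \adj U *m b.
pose d := \det U' *: a - a' *m \adj U' *m V.
(* [U] bordered by the column [b] and by row [i] of [V] and [b'] has determinant [e i 0]. *)
have Ke i : K (e i 0).
  have -> : e i 0 = minor t.+1 (ext rho t (rho' i)) (ext gam t B).
    rewrite minor_ext !mxE mulrC; congr (_ - _).
    apply: eq_bigr => j _; congr (_ * _); rewrite !mxE.
    by apply: eq_bigr => l _; rewrite !mxE.
  exact: Kb.
have Kd j : K (d 0 j).
  have -> : d 0 j = minor t.+1 (ext rho' t A) (ext gam' t (gam j)).
    rewrite minor_ext !mxE mulrC; congr (_ - _).
    by apply: eq_bigr => l _; congr (_ * _); rewrite !mxE.
  exact: Ka.
have Ksum (I : finType) (F : I -> {mpoly k[N]}) : (forall i, K (F i)) ->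
    K (\sum_i F i).
  by move=> KF; elim/big_ind: _.
rewrite !minor_ext -/U -/U' -/a -/a' -/b -/b' -[minor t rho gam]/(\det U).
rewrite -[minor t rho' gam']/(\det U') (exchange_identity _ _ V).
rewrite -/d -/e -mulN1r.
apply: (KD); [|apply: (KM)]; rewrite mxE; apply: (Ksum) => i.
  by rewrite mulrC; apply: (KM).
exact: (KM).
Qed.

End Minors.

(** * Linkage of ladder determinantal ideals *)

Section Ladder.

Variables (k : fieldType) (N : nat) (le : rel 'X_{1..N}).
Hypothesis hle : term_order le.
Variables (u : nat * nat -> 'X_{1..N}) (P Q : nat).
Hypothesis u_var : forall x, in_rect P Q x -> exists i, u x = U_(i)%MM.
Hypothesis u_inj : forall x y, in_rect P Q x -> in_rect P Q y -> u x = u y -> x = y.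

Local Notation minor := (minor k u).
Local Notation chain_minor := (chain_minor k u).
Implicit Types (c : nat * nat * nat) (cs : seq (nat * nat * nat)).
Implicit Types (m : 'X_{1..N}) (p q : {mpoly k[N]}) (s : seq (nat * nat)).

Definition cells m : pred (nat * nat) := fun x => (u x <= m)%MM.

Lemma cellsD x m1 m2 : in_rect P Q x ->
  cells (m1 + m2)%MM x = cells m1 x || cells m2 x.
Proof.
move=> /u_var[i ui]; rewrite /cells ui !lep1mP mnmDE addn_eq0.
by case: (m1 i); case: (m2 i).
Qed.

Lemma cells_u x y : in_rect P Q x -> in_rect P Q y -> cells (u y) x = (x == y).
Proof.
move=> xR yR; apply/idP/eqP=> [|->]; last exact: lepm_refl.
have [i ui] := u_var xR; have [j uj] := u_var yR.
rewrite /cells ui uj lep1mP mnm1E; case: (j =P i) => // ji _.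
by apply: u_inj => //; rewrite ui uj ji.
Qed.

Lemma cells_sum x s : in_rect P Q x -> all (in_rect P Q) s ->
  cells (\sum_(y <- s) u y)%MM x = (x \in s).
Proof.
move=> xR; elim: s => [|y s IHs] /=.
  rewrite big_nil /cells; have [i ->] := u_var xR.
  by rewrite lep1mP mnm0E.
by case/andP=> yR sR; rewrite big_cons cellsD // cells_u // IHs // inE.
Qed.

Lemma lt2_irr : irreflexive lt2.
Proof. by move=> x; rewrite /lt2 ltnn. Qed.

(** A chain repeats no cell and [u] is injective, so the product is squarefree and divides [m] as
    soon as each of its indeterminates does. *)
Lemma sum_cells_le s m : sorted lt2 s -> all (in_rect P Q) s -> all (cells m) s ->
  (\sum_(x <- s) u x <= m)%MM.
Proof.
move=> sort_s sR sm; have us := sorted_uniq lt2_trans lt2_irr sort_s.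
apply/mnm_lepP=> i; rewrite mnm_sumE.
elim: s us sR sm {sort_s} => [|x s IHs] /=; first by rewrite big_nil.
case/andP=> xNs us /andP[xR sR] /andP[xm sm]; rewrite big_cons.
have [j uj] := u_var xR; rewrite uj mnm1E; case: eqP => [ji|_]; last exact: IHs.
rewrite big1_seq ?addn0.
  by move: xm; rewrite /cells uj lep1mP ji lt0n.
move=> y ys; have [l ul] := u_var (allP sR y ys).
rewrite ul mnm1E; case: eqP => // li; case/negP: xNs.
suff ->: x = y by [].
by apply: u_inj; rewrite ?uj ?ul ?ji ?li //; apply: (allP sR).
Qed.

(* (A, B, t) stands for the condition that the t-minors of the first A rows and
   B columns vanish. *)
Definition minor_gen cs q : Prop := exists c, c \in cs /\ exists rho gam,
  [/\ forall i, (i < c.2)%N -> (rho i < c.1.1)%N,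
      forall i, (i < c.2)%N -> (gam i < c.1.2)%N & q = minor c.2 rho gam].

Definition ladder_ideal cs : {mpoly k[N]} -> Prop := ideal_gen (minor_gen cs).

(** The monomials of [J_I]. *)
Definition ladder_mon cs m : Prop :=
  exists2 c : nat * nat * nat, c \in cs & has_chain (cells m) c.1.1 c.1.2 c.2.

(** The order picks the diagonal term of each minor. This is stated per rectangle because the
    assumption on the [f_theta] is used only for chains inside rectangles of the ladder. *)
Definition diagonal_init A B : Prop := forall s, sorted lt2 s -> all (in_rect A B) s ->
  chain_minor s != 0 /\ init_mon le (chain_minor s) = (\sum_(x <- s) u x)%MM.

(** The two sides vary in opposite directions, as for the rectangles under the corners of a
    ladder. *)
Definition staircase c c' : bool :=
  (c.1.1 <= c'.1.1)%N && (c'.1.2 <= c.1.2)%N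
  || (c'.1.1 <= c.1.1)%N && (c.1.2 <= c'.1.2)%N.

Lemma diagonal_initW A B A' B' : (A' <= A)%N -> (B' <= B)%N ->
  diagonal_init A B -> diagonal_init A' B'.
Proof.
move=> leA leB gAB s sort_s sR; apply: gAB => //.
by apply: sub_all sR => x; apply: in_rect_sub.
Qed.

Lemma ladder_ideal_mem cs c rho gam : c \in cs ->
    (forall i, (i < c.2)%N -> (rho i < c.1.1)%N) ->
    (forall i, (i < c.2)%N -> (gam i < c.1.2)%N) ->
  ladder_ideal cs (minor c.2 rho gam).
Proof.
move=> cc rhoP gamP; apply: ideal_gen_mem; exists c.
by split=> //; exists rho, gam.
Qed.

Lemma ladder_ideal_sub cs cs' :
    (forall c, c \in cs -> forall rho gam,
       (forall i, (i < c.2)%N -> (rho i < c.1.1)%N) ->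
       (forall i, (i < c.2)%N -> (gam i < c.1.2)%N) ->
       ladder_ideal cs' (minor c.2 rho gam)) ->
  forall p, ladder_ideal cs p -> ladder_ideal cs' p.
Proof.
move=> sub; apply: ideal_gen_ind; first exact: ideal_gen0.
- by move=> p q; apply: ideal_genD.
- by move=> a p; apply: ideal_genM.
by move=> _ [c [cc [rho [gam [? ? ->]]]]]; apply: sub.
Qed.

Lemma injective_or_collision (f : nat -> nat) t :
  {in [pred i | (i < t)%N] &, injective f} \/
  exists i j, [/\ (i < t)%N, (j < t)%N, i != j & f i = f j].
Proof.
case: (classic (exists i j, [/\ (i < t)%N, (j < t)%N, i != j & f i = f j])).
  by right.
move=> Nex; left=> i j; rewrite !inE => it jt fij.
by apply/eqP/negPn/negP=> ij; apply: Nex; exists i, j.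
Qed.

Lemma injective_bound (f : nat -> nat) t A :
    (forall i, (i < t)%N -> (f i < A)%N) ->
  {in [pred i | (i < t)%N] &, injective f} -> (t <= A)%N.
Proof.
move=> fA f_inj; rewrite -(size_iota 0 A) -{1}(size_iota 0 t) -(size_map f).
apply: uniq_leq_size.
  rewrite map_inj_in_uniq ?iota_uniq // => i j; rewrite !mem_iota /=.
  exact: f_inj.
by move=> _ /mapP[i + ->]; rewrite !mem_iota /= => /fA.
Qed.

Lemma minor_big_eq0 t rho gam A B :
    (forall i, (i < t)%N -> (rho i < A)%N) ->
    (forall i, (i < t)%N -> (gam i < B)%N) ->
  (A < t)%N || (B < t)%N -> minor t rho gam = 0.
Proof.
move=> rP gP; case/orP=> lt_t.
  have [/(injective_bound rP)|[i [j [it jt ij e]]]] := injective_or_collision rho t.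
    by rewrite leqNgt lt_t.
  exact: minor_row_eq0 it jt ij e.
have [/(injective_bound gP)|[i [j [it jt ij e]]]] := injective_or_collision gam t.
  by rewrite leqNgt lt_t.
exact: minor_col_eq0 it jt ij e.
Qed.

(** With distinct rows and columns, at most [A - c.1.1] rows and [B - c.1.2] columns fall outside
    the rectangle of [c]; expansion along these leaves minors of size [c.2] inside it. A repeated
    row or column makes the minor zero. *)
Lemma minor_redundant cs A B t c rho gam : c \in cs ->
    (c.2 + (A - c.1.1) + (B - c.1.2) <= t)%N ->
    (forall i, (i < t)%N -> (rho i < A)%N) ->
    (forall i, (i < t)%N -> (gam i < B)%N) ->
  ladder_ideal cs (minor t rho gam).
Proof.
move=> cc le_t rhoP gamP.
have card_bad (f : nat -> nat) a a' : (forall i, (i < t)%N -> (f i < a)%N) ->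
    {in [pred i | (i < t)%N] &, injective f} ->
    (#|[set i : 'I_t | (a' <= f i)%N]| <= a - a')%N.
  move=> fP f_inj; rewrite cardE -(size_map (fun i : 'I_t => f i)).
  rewrite -(size_iota a' (a - a')); apply: uniq_leq_size.
    rewrite map_inj_in_uniq ?enum_uniq // => i j _ _ /f_inj e; apply: val_inj.
    by apply: e; rewrite inE.
  move=> _ /mapP[i iP ->]; rewrite mem_enum inE in iP.
  have fi := fP i (ltn_ord i).
  by rewrite mem_iota iP subnKC // (leq_trans iP (ltnW fi)).
have [rho_inj|[i [j [it jt ij e]]]] := injective_or_collision rho t; last first.
  rewrite (minor_row_eq0 _ _ _ it jt ij e); exact: ideal_gen0.
have [gam_inj|[i [j [it jt ij e]]]] := injective_or_collision gam t; last first.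
  rewrite (minor_col_eq0 _ _ _ it jt ij e); exact: ideal_gen0.
apply: (@det_in_ideal _ (ladder_ideal cs) _ _ _ c.2 t _
  [set i : 'I_t | (c.1.1 <= rho i)%N] [set i : 'I_t | (c.1.2 <= gam i)%N]).
- exact: ideal_gen0.
- by move=> p q; apply: ideal_genD.
- by move=> a p; apply: ideal_genM.
- apply: leq_trans le_t; apply: leq_add; last exact: card_bad.
  by rewrite leq_add2l; apply: card_bad.
move=> r g rP gP.
rewrite (_ : mxsub r g _ = gmx k u c.2 c.2 (extend0 (fun i => rho (r i)))
                                           (extend0 (fun i => gam (g i)))).
  apply: ladder_ideal_mem => //; apply: extend0_bound => i.
    by have := rP i; rewrite inE -ltnNge.
  by have := gP i; rewrite inE -ltnNge.
by apply/matrixP=> i j; rewrite !mxE !extend0E.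
Qed.

(** A monomial divisible by the diagonal of a chain minor is the initial monomial of a multiple of
    that minor by a monomial, which is homogeneous and lies in the ideal. *)
Lemma ladder_reduce cs D :
    (forall c, c \in cs ->
       [/\ (c.1.1 <= P)%N, (c.1.2 <= Q)%N & diagonal_init c.1.1 c.1.2]) ->
  forall q, (forall m, m \in msupp q -> mdeg m < D)%N ->
  exists2 q', ladder_ideal cs (q - q')
            & q' = 0 \/ ~ ladder_mon cs (init_mon le q').
Proof.
move=> csP; apply: init_reduce => //; first exact: ideal_gen0.
- by move=> p q; apply: ideal_genD.
- by move=> a p; apply: ideal_genM.
move=> m [c cc [s0 [sort0 cs0 sR0 sm0]]].
have [cP cQ c_init] := csP c cc.
pose s := take c.2 s0.
have sort_s : sorted lt2 s by apply: take_sorted.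
have sz : size s = c.2 by rewrite size_take; case: ltngtP cs0.
have sR : all (in_rect c.1.1 c.1.2) s by apply/allP=> x /mem_take /(allP sR0).
have sm : all (cells m) s by apply/allP=> x /mem_take /(allP sm0).
have sPQ : all (in_rect P Q) s by apply: sub_all sR => x; apply: in_rect_sub.
have [s_neq0 s_init] := c_init s sort_s sR.
have le_m := sum_cells_le sort_s sPQ sm.
have X0 : 'X_[k, m - \sum_(x <- s) u x] != 0.
  by rewrite -msupp_eq0 msuppX.
exists ('X_[m - \sum_(x <- s) u x] * chain_minor s).
  apply: ideal_genM; rewrite /chain_minor sz.
  apply: ladder_ideal_mem => // i ic; rewrite -sz in ic;
    by have /andP[] := allP sR _ (mem_nth (0, 0)%N ic).
have [prod0 ->] := init_monM hle X0 s_neq0; split=> //.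
  by rewrite init_monX // s_init submK.
move=> m' /msuppM_le /allpairsP[[m1 m2] [/= m1P m2P ->]].
move: m1P; rewrite msuppX mem_seq1 => /eqP ->.
rewrite -[in RHS](submK le_m) !mdegD; congr (_ + _)%N.
have deg_u x : x \in s -> mdeg (u x) = 1%N.
  by move=> xs; have [i ->] := u_var (allP sPQ x xs); rewrite mdeg1.
rewrite (minor_mdeg _ m2P); last first.
  move=> i j it jt; have [|l ->] := @u_var ((nth (0, 0)%N s i).1, (nth (0, 0)%N s j).2).
    have /andP[h1 _] := allP sPQ _ (mem_nth (0, 0)%N it).
    have /andP[_ h2] := allP sPQ _ (mem_nth (0, 0)%N jt).
    by rewrite /in_rect h1 h2.
  by rewrite mdeg1.
rewrite mdeg_sum big_seq (eq_bigr (fun=> 1%N)) => [|x xs]; last exact: deg_u.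
by rewrite -big_seq big_const_seq iter_addn_0 mul1n count_predT.
Qed.

Lemma chain_rcons s A B : sorted lt2 s -> all (in_rect A B) s ->
  sorted lt2 (rcons s (A, B)) /\ all (in_rect A.+1 B.+1) (rcons s (A, B)).
Proof.
move=> sort_s sR; rewrite -cats1 chain_cat sort_s all_cat /= /in_rect /= !ltnS !leqnn.
split; rewrite !andbT //; apply: sub_all sR => x /andP[h1 h2].
by rewrite !ltnS (ltnW h1) (ltnW h2).
Qed.

Lemma chain_minor_rcons s t A B : size s = t ->
  chain_minor (rcons s (A, B))
  = minor t.+1 (ext (fun i => (nth (0, 0)%N s i).1) t A)
               (ext (fun i => (nth (0, 0)%N s i).2) t B).
Proof.
move=> st; rewrite /chain_minor size_rcons st.
by apply: eq_minor => i; rewrite ltnS leq_eqVlt => /predU1P[->|it];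
  rewrite ?ext_eq ?ext_lt // nth_rcons st ?ltnn ?eqxx ?it.
Qed.

(** * A single linkage step *)

Section Linkage.

Variables (A B t : nat) (cs : seq (nat * nat * nat)).
Hypotheses (tA : (t <= A)%N) (tB : (t <= B)%N).
(** Cells are numbered from [0], so this is the far corner of a rectangle with [A.+1] rows and
    [B.+1] columns. The families [csI], [csN], [csL] define the ideals [I], [N], [L]. *)
Let z := (A, B).
Let csI := (A.+1, B.+1, t.+1) :: cs.
Let csN := [:: (A, B.+1, t.+1), (A.+1, B, t.+1) & cs].
Let csL := (A, B, t) :: cs.
Hypothesis csP : forall c, c \in csI ->
  [/\ (c.1.1 <= P)%N, (c.1.2 <= Q)%N & diagonal_init c.1.1 c.1.2].
(** This lets the indeterminate of [z] be dropped in [mon_N_z], while [cs_sep] is the room required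
    by [chain_extension]. *)
Hypothesis cs_out : forall c, c \in cs -> ~~ in_rect c.1.1 c.1.2 z.
Hypothesis cs_sep : forall c, c \in cs ->
  (c.1.1 + t.+1 < c.2 + A.+1)%N || (c.1.2 + t.+1 < c.2 + B.+1)%N.

Let chain_at s := [/\ sorted lt2 s, size s = t & all (in_rect A B) s].

Let AP : (A < P)%N. Proof. by have [] := csP (mem_head _ _). Qed.
Let BQ : (B < Q)%N. Proof. by have [] := csP (mem_head _ _). Qed.

Let csN_P c : c \in csN ->
  [/\ (c.1.1 <= P)%N, (c.1.2 <= Q)%N & diagonal_init c.1.1 c.1.2].
Proof.
have [_ _ g0] := csP (mem_head _ _).
rewrite !inE => /or3P[/eqP->|/eqP->|cc] /=.
- by split; [exact: ltnW | | apply: diagonal_initW g0].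
- by split; [| exact: ltnW | apply: diagonal_initW g0].
- by apply: csP; rewrite inE cc orbT.
Qed.

Let csN_out c : c \in csN -> ~~ in_rect c.1.1 c.1.2 z.
Proof.
by rewrite !inE => /or3P[/eqP->|/eqP->|/cs_out //]; rewrite /in_rect /= ltnn ?andbF.
Qed.

(** A [t.+1]-minor of either new rectangle of [csN] uses at most one row or column outside [(A, B)],
    so it expands into [t]-minors inside. *)
Let csN_sub_L p : ladder_ideal csN p -> ladder_ideal csL p.
Proof.
apply: ladder_ideal_sub => c; rewrite !inE => /or3P[/eqP->|/eqP->|cc] rho gam /= rP gP.
- apply: (minor_redundant (mem_head _ _) _ rP gP) => /=.
  by rewrite subnn subSn // subnn addn0 addn1.
- apply: (minor_redundant (mem_head _ _) _ rP gP) => /=.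
  by rewrite subnn subSn // subnn addn0 addn1.
- by apply: ladder_ideal_mem; rewrite ?inE ?cc ?orbT.
Qed.

Let mon_N_I m : ladder_mon csN m -> ladder_mon csI m.
Proof.
case=> c; rewrite !inE => /or3P[/eqP->|/eqP->|cc] h.
- exists (A.+1, B.+1, t.+1); rewrite ?mem_head //.
  by apply: has_chain_sub h => //=.
- exists (A.+1, B.+1, t.+1); rewrite ?mem_head //.
  by apply: has_chain_sub h => //=.
- by exists c; rewrite ?inE ?cc ?orbT.
Qed.

Let mon_N_z m : ladder_mon csN (m + u z) -> ladder_mon csN m.
Proof.
case=> c cc h; exists c => //; apply: has_chain_sub h => // x xR.
have [cP cQ _] := csN_P cc.
have xPQ : in_rect P Q x by apply: in_rect_sub xR.
rewrite cellsD // cells_u //; last by rewrite /in_rect AP BQ.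
case/orP=> // /eqP xz; case/negP: (csN_out cc); by rewrite -xz.
Qed.

Let mon_L_I m : ladder_mon csL m -> ladder_mon csI (u z + m).
Proof.
have le_uz x : cells m x -> cells (u z + m) x.
  by move=> xm; apply: lepm_trans xm _; apply: lem_addl.
case=> c; rewrite !inE => /predU1P[->|cc] h; last first.
  exists c; first by rewrite inE cc orbT.
  by apply: has_chain_sub h => // x _; apply: le_uz.
case: h => s [sort_s ts sR sm]; exists (A.+1, B.+1, t.+1); first exact: mem_head.
have [sort_z zR] := chain_rcons sort_s sR.
exists (rcons s z); split=> //; first by rewrite size_rcons ltnS.
rewrite all_rcons; apply/andP; split; first exact: lem_addr.
exact: sub_all sm.
Qed.

Let chain_avoiding m : ~ ladder_mon csN m ->
  exists2 s, chain_at s & ~ ladder_mon csN (m + \sum_(x <- s) u x).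
Proof.
move=> Nm; have [||||g [sort_g size_g gR gN]] :=
    @chain_extension (cells m) csN A.+1 B.+1 t.
- by rewrite ltnS.
- by rewrite ltnS.
- move=> c; rewrite !inE => /or3P[/eqP->|/eqP->|/cs_sep //] /=.
    by rewrite addnC ltn_add2l ltnSn.
  by apply/orP; right; rewrite addnC ltn_add2l.
- by move=> c cc h; apply: Nm; exists c.
exists g => // -[c cc h]; apply: (gN c cc); apply: has_chain_sub h => // x xR.
have [cP cQ _] := csN_P cc.
have gPQ : all (in_rect P Q) g.
  by apply: sub_all gR => y; apply: in_rect_sub; rewrite /= ltnW.
have xPQ : in_rect P Q x by apply: in_rect_sub xR.
by rewrite cellsD // cells_sum.
Qed.

(** One companion [q] must serve all chains [s], because the chain is chosen only after the initial
    monomials of [p] and [q] are known. *)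
Let linked p := exists2 q, ladder_ideal csL q & forall s, chain_at s ->
  ladder_ideal csN (chain_minor s * p - chain_minor (rcons s z) * q).

Let linked0 p : ladder_ideal csN p -> linked p.
Proof.
move=> Np; exists 0; first exact: ideal_gen0.
by move=> s _; rewrite mulr0 subr0; apply: ideal_genM.
Qed.

Let linkedM a p : linked p -> linked (a * p).
Proof.
move=> [q Lq qP]; exists (a * q); first exact: ideal_genM.
move=> s /qP; rewrite (mulrCA (chain_minor s)) (mulrCA (chain_minor (rcons s z))).
by rewrite -mulrBr; apply: ideal_genM.
Qed.

(** The companion is the cofactor of [z]. In each minor required by [minor_exchange] the rows stay
    below [A] or the columns below [B], so it lies in [N]. If row [A] or column [B] is repeated, the
    minor is zero. *)
Let linked_corner rho gam : rho t = A -> gam t = B ->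
    (forall i, (i < t.+1)%N -> (rho i < A.+1)%N) ->
    (forall i, (i < t.+1)%N -> (gam i < B.+1)%N) ->
  linked (minor t.+1 rho gam).
Proof.
move=> rt gt rP gP.
have minor0 : minor t.+1 rho gam = 0 -> linked (minor t.+1 rho gam).
  by move=> ->; apply: linked0; apply: ideal_gen0.
case: (boolP [exists i : 'I_t, rho i == A]) => [/existsP[i /eqP ri]|rN].
  have it : (i < t.+1)%N by rewrite ltnS ltnW.
  apply/minor0/(minor_row_eq0 _ _ _ it (ltnSn t)); last by rewrite ri rt.
  by rewrite neq_ltn ltn_ord.
case: (boolP [exists i : 'I_t, gam i == B]) => [/existsP[i /eqP gi]|gN].
  have it : (i < t.+1)%N by rewrite ltnS ltnW.
  apply/minor0/(minor_col_eq0 _ _ _ it (ltnSn t)); last by rewrite gi gt.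
  by rewrite neq_ltn ltn_ord.
have rP' i : (i < t)%N -> (rho i < A)%N.
  move=> it; have := rP i (ltnW it); rewrite ltnS leq_eqVlt => /predU1P[ri|//].
  by case/existsP: rN; exists (Ordinal it); rewrite /= ri.
have gP' i : (i < t)%N -> (gam i < B)%N.
  move=> it; have := gP i (ltnW it); rewrite ltnS leq_eqVlt => /predU1P[gi|//].
  by case/existsP: gN; exists (Ordinal it); rewrite /= gi.
exists (minor t rho gam).
  exact: (@ladder_ideal_mem csL (A, B, t) rho gam (mem_head _ _)).
move=> s [sort_s st sR]; rewrite (chain_minor_rcons _ _ st) /chain_minor st.
rewrite (@eq_minor _ _ _ t.+1 rho (ext rho t A) gam (ext gam t B)); last 2 first.
- by move=> i; rewrite ltnS leq_eqVlt => /predU1P[->|it]; rewrite ?ext_eq ?ext_lt.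
- by move=> i; rewrite ltnS leq_eqVlt => /predU1P[->|it]; rewrite ?ext_eq ?ext_lt.
have sP i : (i < t)%N -> in_rect A B (nth (0, 0)%N s i).
  by move=> it; apply/(allP sR)/mem_nth; rewrite st.
apply: minor_exchange; first exact: ideal_gen0.
- by move=> p q; apply: ideal_genD.
- by move=> a p; apply: ideal_genM.
- move=> i it; apply: (@ladder_ideal_mem csN (A, B.+1, t.+1)); first exact: mem_head.
    move=> j; rewrite ltnS leq_eqVlt => /predU1P[->|jt]; rewrite ?ext_eq ?ext_lt //.
      exact: rP'.
    by have /andP[] := sP j jt.
  move=> j; rewrite ltnS leq_eqVlt => /predU1P[->|jt]; rewrite ?ext_eq ?ext_lt //.
  by have /andP[_ /ltnW] := sP j jt.
- move=> i it; apply: (@ladder_ideal_mem csN (A.+1, B, t.+1)).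
  + by rewrite !inE eqxx orbT.
  + move=> j; rewrite ltnS leq_eqVlt => /predU1P[->|jt]; rewrite ?ext_eq ?ext_lt //.
    by apply/ltnW/rP'.
  + move=> j; rewrite ltnS leq_eqVlt => /predU1P[->|jt]; rewrite ?ext_eq ?ext_lt //.
      by have /andP[] := sP i it.
    exact: gP'.
Qed.

(** A generator from [cs], or one missing row [A] or column [B], lies in [N] and has companion [0].
    In the others, swaps bring that row and column to the last position at the cost of a sign. *)
Let ideal_linked p : ladder_ideal csI p -> linked p.
Proof.
apply: ideal_gen_ind; first by apply: linked0; apply: ideal_gen0.
- move=> p1 p2 [q1 L1 q1P] [q2 L2 q2P]; exists (q1 + q2); first exact: ideal_genD.
  move=> s sP; rewrite !mulrDr opprD addrACA.
  by apply: ideal_genD; [apply: q1P | apply: q2P].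
- by move=> a p1; apply: linkedM.
move=> _ [c [cI [rho [gam [rP gP ->]]]]]; move: cI rP gP.
rewrite inE => /predU1P[->|cc] /= rP gP; last first.
  by apply/linked0/ladder_ideal_mem => //; rewrite !inE cc !orbT.
case: (boolP [exists i : 'I_t.+1, A <= rho i]%N) => [/existsP[i ri]|rN]; last first.
  apply/linked0/(@ladder_ideal_mem csN (A, B.+1, t.+1)) => //; first exact: mem_head.
  move=> i it; rewrite ltnNge; apply: contra rN => ri.
  by apply/existsP; exists (Ordinal it).
case: (boolP [exists i : 'I_t.+1, B <= gam i]%N) => [/existsP[j gj]|gN]; last first.
  apply/linked0/(@ladder_ideal_mem csN (A.+1, B, t.+1)) => //.
    by rewrite !inE eqxx orbT.
  move=> i' it; rewrite ltnNge; apply: contra gN => gi.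
  by apply/existsP; exists (Ordinal it).
have ri' : rho i = A by apply/eqP; rewrite eqn_leq ri -ltnS rP.
have gj' : gam j = B by apply/eqP; rewrite eqn_leq gj -ltnS gP.
have [e ->] := minor_row_swap k u rho gam (ltn_ord i) (ltnSn t).
apply: linkedM.
have [e' ->] := minor_col_swap k u (swap rho i t) gam (ltn_ord j) (ltnSn t).
apply: linkedM.
have swapP (f : nat -> nat) l C : (forall i', (i' < t.+1)%N -> (f i' < C)%N) ->
    (l < t.+1)%N -> forall i', (i' < t.+1)%N -> (swap f l t i' < C)%N.
  by move=> fP lt i' it'; rewrite /swap; case: ifP => _; [|case: ifP => _]; apply: fP.
have swap_last (f : nat -> nat) l : swap f l t t = f l.
  by rewrite /swap eqxx; case: eqP => // ->.
by apply: linked_corner; rewrite ?swap_last //; apply: swapP.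
Qed.

Hypothesis IHN : forall p, ladder_ideal csN p -> p != 0 -> ladder_mon csN (init_mon le p).
Hypothesis IHL : forall p, ladder_ideal csL p -> p != 0 -> ladder_mon csL (init_mon le p).

Lemma linkage p : ladder_ideal csI p -> p != 0 -> ladder_mon csI (init_mon le p).
Proof.
move=> Ip p0; case: (classic (ladder_mon csN (init_mon le p))) => [/mon_N_I //|Np].
have [q0 Lq0 q0P] := ideal_linked Ip.
(* Reducing [q0] modulo [N] keeps its relation to [p] and puts the initial monomial of [q] outside
   [J_N], unless [q] is zero. *)
have [q Nq qP] := @ladder_reduce csN (msize q0) csN_P q0 (@msize_mdeg_lt _ _ q0).
have Lq : ladder_ideal csL q.
  rewrite -[q](subKr q0) -mulN1r; apply: ideal_genD => //.
  by apply: ideal_genM; apply: csN_sub_L.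
have rel s : chain_at s ->
    ladder_ideal csN (chain_minor s * p - chain_minor (rcons s z) * q).
  move=> sP; have -> : chain_minor s * p - chain_minor (rcons s z) * q
      = (chain_minor s * p - chain_minor (rcons s z) * q0)
        + chain_minor (rcons s z) * (q0 - q).
    by rewrite mulrBr addrA subrK.
  by apply: ideal_genD; [apply: q0P | apply: ideal_genM].
have [_ _ g0] := csP (mem_head _ _).
have init_g s : chain_at s ->
    chain_minor s != 0 /\ init_mon le (chain_minor s) = (\sum_(x <- s) u x)%MM.
  case=> sort_s _ sR; apply: g0 => //.
  by apply: sub_all sR => x; apply: in_rect_sub => /=.
have init_f s : chain_at s -> chain_minor (rcons s z) != 0 /\
    init_mon le (chain_minor (rcons s z)) = (\sum_(x <- s) u x + u z)%MM.
  case=> sort_s _ sR; have [sort_z zR] := chain_rcons sort_s sR.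
  by have [-> ->] := g0 _ sort_z zR; rewrite big_rcons.
have init_gp s : chain_at s -> chain_minor s * p != 0 /\
    init_mon le (chain_minor s * p) = (init_mon le p + \sum_(x <- s) u x)%MM.
  move=> /init_g[g_neq0 g_init]; have [-> ->] := init_monM hle g_neq0 p0.
  by rewrite g_init addmC.
have init_fq s : q != 0 -> chain_at s -> chain_minor (rcons s z) * q != 0 /\
    init_mon le (chain_minor (rcons s z) * q)
      = ((init_mon le q + \sum_(x <- s) u x) + u z)%MM.
  move=> nq /init_f[f_neq0 f_init]; have [-> ->] := init_monM hle f_neq0 nq.
  by rewrite f_init addmC addmA.
(* Were [q] zero, [g p] would lie in [N] for each [g], which the chain avoiding [J_N] forbids. *)
have nq : q != 0.
  apply/eqP => qE; have [s sP NmP] := chain_avoiding Np.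
  have [gp0 gpE] := init_gp s sP; case: NmP; rewrite -gpE; apply: IHN => //.
  by have := rel s sP; rewrite qE mulr0 subr0.
have {qP}Nq' : ~ ladder_mon csN (init_mon le q).
  by case: qP => // /eqP; rewrite (negPf nq).
have le_total m m' : le m m' \/ le m' m.
  by apply/orP; case: hle => _ _ h _ _; apply: h.
suff -> : init_mon le p = (u z + init_mon le q)%MM by apply/mon_L_I/IHL.
(* If the two monomials differ, the larger of the initial monomials of [g p] and [f q] survives in
   their difference, which lies in [N]. The chain is chosen to keep that one outside [J_N], after
   removal of [z] in the case of [f q]. *)
case: (le_total (init_mon le p) (u z + init_mon le q)%MM) => le_pq.
  have [s sP NmP] := chain_avoiding Nq'.
  have [gp0 gpE] := init_gp s sP; have [fq0 fqE] := init_fq s nq sP.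
  apply/eqP/negPn/negP=> ne_pq; apply: NmP; apply: mon_N_z; rewrite -fqE.
  have [||d0 <-] := init_monB hle fq0 gp0.
  - rewrite fqE gpE; apply: contra ne_pq; rewrite [(_ + u z)%MM]addmC addmA eqm_add2r.
    by move/eqP->.
  - by rewrite fqE gpE [(_ + u z)%MM]addmC addmA (term_le_add hle).
  apply: IHN => //; rewrite -opprB -mulN1r; apply: ideal_genM; exact: rel.
have [s sP NmP] := chain_avoiding Np.
have [gp0 gpE] := init_gp s sP; have [fq0 fqE] := init_fq s nq sP.
apply/eqP/negPn/negP=> ne_pq; apply: NmP; rewrite -gpE.
have [||d0 <-] := init_monB hle gp0 fq0.
- by rewrite fqE gpE [(_ + u z)%MM]addmC addmA eqm_add2r.
- by rewrite fqE gpE [(_ + u z)%MM]addmC addmA (term_le_add hle).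
by apply: IHN => //; apply: rel.
Qed.

End Linkage.

(** * Induction over families of conditions *)

Definition area cs := (\sum_(c <- cs) 3 ^ (c.1.1 + c.1.2))%N.

Lemma mem_remP c cs c' : c \in cs -> (c' \in cs) = (c' == c) || (c' \in rem c cs).
Proof. by move=> cc; rewrite (perm_mem (perm_to_rem cc)) inE. Qed.

Lemma area_rem c cs : c \in cs ->
  area cs = (3 ^ (c.1.1 + c.1.2) + area (rem c cs))%N.
Proof. by move=> cc; rewrite /area (perm_big _ (perm_to_rem cc)) big_cons. Qed.

Lemma exists_largest cs : cs != [::] -> exists2 c : nat * nat * nat, c \in cs &
  forall c' : nat * nat * nat, c' \in cs -> (c'.1.1 + c'.1.2 <= c.1.1 + c.1.2)%N.
Proof.
elim: cs => // c cs IHcs _; case: (eqVneq cs [::]) => [->|/IHcs[c' cc' max_c']].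
  by exists c; rewrite ?mem_head // => c'; rewrite inE => /eqP->.
case: (leqP (c.1.1 + c.1.2) (c'.1.1 + c'.1.2)) => le_cc'.
  exists c'; first by rewrite inE cc' orbT.
  by move=> x; rewrite inE => /predU1P[->|/max_c'].
exists c; first exact: mem_head.
move=> x; rewrite inE => /predU1P[->|/max_c' le_x] //.
exact: leq_trans le_x (ltnW le_cc').
Qed.

Lemma staircase_sym c c' : staircase c c' = staircase c' c.
Proof. by rewrite /staircase orbC. Qed.

Lemma staircase_refl c : staircase c c.
Proof. by rewrite /staircase !leqnn. Qed.

Theorem ladder_groebner cs :
    (forall c, c \in cs ->
       [/\ (c.1.1 <= P)%N, (c.1.2 <= Q)%N & diagonal_init c.1.1 c.1.2]) ->
    (forall c c', c \in cs -> c' \in cs -> staircase c c') ->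
  forall p, ladder_ideal cs p -> p != 0 -> ladder_mon cs (init_mon le p).
Proof.
have [n] := ubnP (area cs); elim: n cs => // n IHn cs; rewrite ltnS => area_n.
move=> csP cs_staircase p Ip p0.
have drop c : c \in cs -> (forall rho gam,
      (forall i, (i < c.2)%N -> (rho i < c.1.1)%N) ->
      (forall i, (i < c.2)%N -> (gam i < c.1.2)%N) ->
      ladder_ideal (rem c cs) (minor c.2 rho gam)) ->
    ladder_mon cs (init_mon le p).
  move=> cc c_red.
  have sub c' : c' \in rem c cs -> c' \in cs by exact: mem_rem.
  have [||||c' c'c mon] := IHn (rem c cs) _ _ _ p _ p0.
  - apply: leq_trans area_n; rewrite (area_rem cc) -addn1 addnC leq_add2r.
    by rewrite expn_gt0.
  - by move=> c' /sub/csP.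
  - by move=> c1 c2 /sub h1 /sub h2; apply: cs_staircase.
  - apply: ladder_ideal_sub Ip => c'; rewrite (mem_remP _ cc).
    case/predU1P=> [->|c'c] rho gam rP gP; first exact: c_red.
    exact: ladder_ideal_mem.
  by exists c'; first exact: sub.
(* For [t = 0] the empty chain lies in the support of every monomial. *)
case: (boolP (has (fun c => c.2 == 0)%N cs)) => [/hasP[c cc /eqP t0]|/hasPn t_gt0].
  by exists c => //; exists [::]; rewrite t0.
pose implied c c' := (c'.2 + (c.1.1 - c'.1.1) + (c.1.2 - c'.1.2) <= c.2)%N.
case: (boolP (has (fun c => has (implied c) (rem c cs)) cs)).
  case/hasP=> c cc /hasP[c' c'c imp]; apply: (drop c cc) => rho gam rP gP.
  exact: minor_redundant imp rP gP.
move=> no_implied.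
have {no_implied}not_implied c c' : c \in cs -> c' \in rem c cs -> ~~ implied c c'.
  move=> cc c'c; apply: contra no_implied => imp.
  by apply/hasP; exists c => //; apply/hasP; exists c'.
case: (boolP (has (fun c => (c.1.1 < c.2) || (c.1.2 < c.2))%N cs)).
  case/hasP=> c cc big_t; apply: (drop c cc) => rho gam rP gP.
  rewrite (minor_big_eq0 rP gP big_t); exact: ideal_gen0.
move=> /hasPn small_t.
case: (eqVneq cs [::]) => [cs0|cs_neq0].
  move: Ip p0; rewrite cs0 => Ip; suff ->: p = 0 by rewrite eqxx.
  apply: (ideal_gen_ind (K := fun q => q = 0)) Ip => //.
  - by move=> x y -> ->; rewrite addr0.
  - by move=> a x ->; rewrite mulr0.
  - by move=> x [c []].
have [c cc c_max] := exists_largest cs_neq0.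
(* If the corner of [c] lay in another rectangle, maximality would make the two rectangles equal,
   and one of the two conditions would imply the other. *)
have c_rem c' : c' \in rem c cs -> [/\ c' \in cs, ~~ implied c c'
    & ~~ in_rect c'.1.1 c'.1.2 (c.1.1.-1, c.1.2.-1)].
  move=> c'c; have c'cs : c' \in cs by exact: mem_rem c'c.
  have imp1 := not_implied c c' cc c'c; split=> //.
  apply/negP=> /andP[/= lt1 lt2'].
  have h1 : (c'.1.1 + c'.1.2 <= c.1.1 + c.1.2)%N := c_max c' c'cs.
  have t0 : (0 < c.2)%N by rewrite lt0n; apply: t_gt0.
  have [h2 h3] : (c.2 <= c.1.1)%N /\ (c.2 <= c.1.2)%N.
    by apply/andP; have := small_t c cc; rewrite negb_or -!leqNgt.
  have [e1 e2] : c.1.1 = c'.1.1 /\ c.1.2 = c'.1.2.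
    by clear -lt1 lt2' h1 h2 h3 t0; lia.
  have lt_t : (c.2 < c'.2)%N.
    by move: imp1; rewrite /implied e1 e2 !subnn !addn0 -ltnNge.
  have ne : c != c' by apply: contraTneq lt_t => ->; rewrite ltnn.
  have cc' : c \in rem c' cs.
    by move: cc; rewrite (mem_remP _ c'cs) (negPf ne).
  have := not_implied c' c c'cs cc'; rewrite /implied e1 e2 !subnn !addn0.
  by rewrite (ltnW lt_t).
case: c => [[[|A] [|B]] [|t]] in cc c_max c_rem *;
  have := t_gt0 _ cc => // _; have := small_t _ cc; rewrite /= ?orbT // => small.
have tA : (t <= A)%N by move: small; rewrite negb_or -!leqNgt => /andP[].
have tB : (t <= B)%N by move: small; rewrite negb_or -!leqNgt => /andP[].
set c := (A.+1, B.+1, t.+1) in cc c_max c_rem.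
have c_staircase c' : c' \in rem c cs -> staircase c c'.
  by case/c_rem=> c'cs _ _; apply: cs_staircase.
have I_eq x : (x \in c :: rem c cs) = (x \in cs) by rewrite (mem_remP _ cc) inE.
have csP' x : x \in c :: rem c cs ->
    [/\ (x.1.1 <= P)%N, (x.1.2 <= Q)%N & diagonal_init x.1.1 x.1.2].
  by rewrite I_eq; apply: csP.
have [/= AP BQ gAB] := csP c cc.
have rem_staircase c1 c2 : c1 \in rem c cs -> c2 \in rem c cs -> staircase c1 c2.
  by move=> /c_rem[c1c _ _] /c_rem[c2c _ _]; apply: cs_staircase.
have [|||||c' c'c mon] := @linkage A B t (rem c cs) tA tB csP' _ _ _ _ p _ p0.
- by move=> c' /c_rem[].
(* By [staircase] one of the two truncated differences in [implied] vanishes; the failure of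
   [implied] then bounds the other. *)
- move=> c' c'c; have [_ + _] := c_rem c' c'c; have := c_staircase c' c'c.
  by rewrite /staircase /implied /= => h1 h2; clear -h1 h2; lia.
(* Shortening a side of the rectangle of [c] preserves the staircase because no other rectangle
   contains the corner. *)
- have N_staircase c1 c' : c1 \in [:: (A, B.+1, t.+1); (A.+1, B, t.+1)] ->
      c' \in rem c cs -> staircase c1 c'.
    move=> c1P c'c; have [_ _] := c_rem c' c'c; have := c_staircase c' c'c.
    rewrite /staircase /in_rect /=; move: c1P; rewrite !inE => /orP[]/eqP-> /= h1 h2;
      by clear -h1 h2; lia.
  apply: IHn.
  (* Two rectangles, each with one side shorter by one, together weigh two thirds of the old one;
     this is the reason for base 3 in [area]. *)
  + apply: leq_trans area_n; rewrite (area_rem cc) /area !big_cons /=.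
    rewrite addnA ltn_add2r !addnS !addSn !expnS.
    by have := expn_gt0 3 (A + B); lia.
  + move=> c'; rewrite !inE => /or3P[/eqP->|/eqP->|c'c] /=.
    * by split; [exact: ltnW | | apply: diagonal_initW gAB].
    * by split; [| exact: ltnW | apply: diagonal_initW gAB].
    * by apply: csP'; rewrite inE c'c orbT.
  + move=> c1 c2; rewrite !inE => /or3P[/eqP->|/eqP->|c1c] /or3P[/eqP->|/eqP->|c2c];
      rewrite ?staircase_refl //; try by rewrite /staircase /= !leqnSn ?orbT.
    * exact: N_staircase (mem_head _ _) c2c.
    * by apply: N_staircase c2c; rewrite !inE eqxx orbT.
    * by rewrite staircase_sym; apply: N_staircase (mem_head _ _) c1c.
    * by rewrite staircase_sym; apply: N_staircase c1c; rewrite !inE eqxx orbT.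
    * exact: rem_staircase.
- have L_staircase c' : c' \in rem c cs -> staircase (A, B, t) c'.
    move=> c'c; have [_ _] := c_rem c' c'c; have := c_staircase c' c'c.
    by rewrite /staircase /in_rect /= => h1 h2; clear -h1 h2; lia.
  apply: IHn.
  + apply: leq_trans area_n; rewrite (area_rem cc) /area !big_cons /=.
    rewrite ltn_add2r !addnS !addSn !expnS.
    by have := expn_gt0 3 (A + B); lia.
  + move=> c'; rewrite inE => /predU1P[->|c'c] /=.
      by split; [exact: ltnW | exact: ltnW | apply: diagonal_initW gAB].
    by apply: csP'; rewrite inE c'c orbT.
  + move=> c1 c2; rewrite !inE => /predU1P[->|c1c] /predU1P[->|c2c].
    * exact: staircase_refl.
    * exact: L_staircase.
    * by rewrite staircase_sym; apply: L_staircase.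
    * exact: rem_staircase.
- apply: ladder_ideal_sub Ip => c'; rewrite -I_eq => c'I rho gam rP gP.
  exact: ladder_ideal_mem c'I rP gP.
by exists c' => //; rewrite -I_eq.
Qed.

End Ladder.

(** * Subsets of an interval *)

(** By downward closure [p] holds exactly on an initial segment of [s], whose length is the
    count. *)
Lemma sorted_count (T : Type) (r : rel T) (p : pred T) (x0 : T) s i :
    transitive r -> (forall x y, r x y -> p y -> p x) -> sorted r s ->
  (i < size s)%N -> (i < count p s)%N = p (nth x0 s i).
Proof.
move=> r_trans p_down; elim: s i => // x s IHs i /= sort_xs.
have sort_s := path_sorted sort_xs.
case: (boolP (p x)) => px.
  by case: i => [|i] it /=; [rewrite px | rewrite add1n ltnS IHs].
have Nps : all (predC p) s.
  apply: sub_all (order_path_min r_trans sort_xs) => y xy /=.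
  by apply: contra px; apply: p_down.
have -> : count p s = 0%N.
  by apply/eqP; rewrite -leqn0 leqNgt -has_count -all_predC.
case: i => [|i] it /=; first by rewrite (negPf px).
by rewrite add0n ltn0; apply/esym/negbTE/(all_nthP x0 Nps).
Qed.

Lemma ltn_ord_trans n : transitive (relpre (@nat_of_ord n) ltn).
Proof. by move=> y x z /=; apply: ltn_trans. Qed.

Lemma sorted_enum_set n (A : {set 'I_n}) : sorted (relpre val ltn) (enum A).
Proof.
rewrite {1}/enum_mem; apply: sorted_filter; first exact: ltn_ord_trans.
by rewrite -enumT -sorted_map val_enum_ord iota_ltn_sorted.
Qed.

Lemma count_enum n (A : {set 'I_n}) (p : pred 'I_n) :
  count p (enum A) = #|[set i in A | p i]|.
Proof.
rewrite -sum1_count big_enum_cond /= -sum1_card.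
by apply: eq_bigl => i; rewrite inE.
Qed.

Definition cut n (A : {set 'I_n}) (x : nat) : nat := #|[set i in A | (i < x)%N]|.

Lemma cut_mono n (A : {set 'I_n}) x y : (x <= y)%N -> (cut A x <= cut A y)%N.
Proof.
move=> xy; apply/subset_leq_card/subsetP=> i; rewrite !inE => /andP[-> ix].
exact: leq_trans ix xy.
Qed.

Section Subsets.

Variables (d n : nat).
Implicit Types (a b : Idn d n).

Lemma size_enum_Idn a : size (enum a) = d.
Proof. by rewrite -cardE card_Idn. Qed.

Lemma eltE a (i : 'I_d) x0 : elt a i = nth x0 (enum a) i.
Proof. by rewrite /elt (enum_val_nth x0). Qed.

Lemma elt_in a i : elt a i \in a.
Proof. exact: enum_valP. Qed.

Lemma elt_inj a : injective (elt a).
Proof. by move=> i j /enum_val_inj/cast_ord_inj. Qed.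

Lemma elt_surj a r : r \in a -> exists i, elt a i = r.
Proof.
move=> ra; exists (cast_ord (card_Idn a) (enum_rank_in ra r)).
by rewrite /elt cast_ordK enum_rankK_in.
Qed.

Lemma cut_le_size a x : (cut a x <= d)%N.
Proof.
rewrite -[leqRHS](card_Idn a); apply/subset_leq_card/subsetP=> i.
by rewrite inE => /andP[].
Qed.

Lemma ltn_cut a x (i : 'I_d) : (i < cut a x)%N = (elt a i < x)%N.
Proof.
rewrite /cut -(count_enum a (fun i => i < x)%N) (eltE a i (elt a i)).
apply: (sorted_count (r := relpre val ltn)).
- exact: ltn_ord_trans.
- by move=> y z /= yz; apply: ltn_trans.
- exact: sorted_enum_set.
- by rewrite size_enum_Idn.
Qed.

Lemma card_elt_cut a x : #|[set i : 'I_d | (elt a i < x)%N]| = cut a x.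
Proof.
rewrite -(card_imset _ (@elt_inj a)) /cut; apply: eq_card => r; rewrite inE.
apply/imsetP/andP=> [[i]|[/elt_surj[i <-] ix]].
  by rewrite inE => ? ->; rewrite elt_in.
by exists i; rewrite ?inE.
Qed.

(** By [ltn_cut] the functions [elt a] and [cut a] determine each other, so comparing entries
    amounts to comparing counts in the reverse direction. Thresholds are what index the conditions
    of the ladder. *)
Lemma Idn_leP a b : reflect (forall x, cut b x <= cut a x)%N (Idn_le a b).
Proof.
apply: (iffP forallP) => [le_ab x|le_cut i]; last first.
  by rewrite -ltnS -ltn_cut; apply: leq_trans (le_cut _); rewrite ltn_cut.
rewrite leqNgt; apply/negP=> lt_cut.
have lt_d : (cut a x < d)%N by apply: leq_trans lt_cut (cut_le_size b x).
have := ltn_cut a x (Ordinal lt_d); rewrite ltnn => /esym/negbT/negP; apply.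
by apply: leq_ltn_trans (le_ab _) _; rewrite -ltn_cut.
Qed.

Lemma Idn_leN a b : ~~ Idn_le a b -> exists2 x, (x < n)%N & (cut a x < cut b x)%N.
Proof.
rewrite negb_forall => /existsP[i]; rewrite -ltnNge => lt_ba.
exists (elt a i) => //; rewrite -ltn_cut in lt_ba.
by apply: leq_ltn_trans lt_ba; rewrite leqNgt ltn_cut ltnn.
Qed.

End Subsets.

(** Every column is below every row, so the greedy choice takes the largest remaining column,
    whatever the row. *)
Lemma greedy_nested n (l : seq ('I_n * 'I_n)) (A : {set 'I_n}) :
    A =i map snd l -> sorted (fun p q : 'I_n * 'I_n => q.2 < p.2)%N l ->
    (forall p q, p \in l -> q \in l -> (p.2 < q.1)%N) ->
  greedy_pairs (map fst l) A = l.
Proof.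
elim: l A => //= -[r c] l IHl A AE sort_l lt_l.
have tr : transitive (fun p q : 'I_n * 'I_n => q.2 < p.2)%N.
  by move=> y x z /= yx zy; apply: ltn_trans zy yx.
have c_max := order_path_min tr sort_l.
have Ac : c \in A by rewrite AE inE eqxx.
have A_le c' : c' \in A -> (c' <= c)%N.
  rewrite AE inE => /predU1P[->//|/mapP[p pl ->]]; exact/ltnW/(allP c_max).
have -> : largest_below A r = Some c.
  rewrite /largest_below; case: pickP => [c2 /and3P[Ac2 _ /forallP max2]|/(_ c)].
    congr Some; apply/val_inj/eqP; rewrite eqn_leq A_le //=.
    have /implyP/(_ Ac)/implyP := max2 c; apply.
    exact: (lt_l (r, c) (r, c) (mem_head _ _) (mem_head _ _)).
  rewrite /= Ac (lt_l (r, c) (r, c) (mem_head _ _) (mem_head _ _)) /=.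
  move/negbT/forallPn=> -[c']; rewrite negb_imply => /andP[Ac'].
  by rewrite (A_le _ Ac') implybT.
rewrite IHl //; first last.
- by move=> p q pl ql; apply: lt_l; rewrite inE ?pl ?ql orbT.
- exact: path_sorted sort_l.
move=> x; rewrite !inE AE inE; case: eqP => //= -> /=.
apply/esym/negbTE/mapP=> -[p /(allP c_max) /= lt_c cE].
by rewrite cE ltnn in lt_c.
Qed.

(** * The grid attached to v *)

Section Grid.

Variables (d n : nat) (v : Idn d n) (r0 : 'I_n).

(* Rows of the grid are the elements of the complement of v in decreasing
   order, columns are the elements of v in increasing order, so that the
   region r >= x > c becomes a rectangle with a corner at the origin. *)
Definition row_elt (a : nat) : 'I_n := nth r0 (rev (enum (~: v))) a.

Definition col_elt (b : nat) : 'I_n := nth r0 (enum v) b.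

Definition cell_mon (x : nat * nat) : 'X_{1..nvars v} :=
  if insub (row_elt x.1, col_elt x.2) is Some b then U_(enum_rank (b : Rtype v))%MM
  else 0%MM.

Definition row_cut (x : nat) : nat := #|[set r in ~: v | (x <= r)%N]|.

Lemma size_rows : size (rev (enum (~: v))) = #|~: v|.
Proof. by rewrite size_rev -cardE. Qed.

Lemma row_elt_notin a : (a < #|~: v|)%N -> row_elt a \notin v.
Proof.
rewrite -size_rows => aP; have := mem_nth r0 aP.
by rewrite mem_rev mem_enum inE.
Qed.

Lemma col_elt_in b : (b < d)%N -> col_elt b \in v.
Proof.
by rewrite -{1}(size_enum_Idn v) => bd; have := mem_nth r0 bd; rewrite mem_enum.
Qed.

Lemma col_eltE (j : 'I_d) : col_elt j = elt v j.
Proof. by rewrite (eltE v j r0). Qed.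

Lemma row_cut_le x : (row_cut x <= #|~: v|)%N.
Proof. by apply/subset_leq_card/subsetP=> r; rewrite inE => /andP[]. Qed.

Lemma row_cut_anti x y : (x <= y)%N -> (row_cut y <= row_cut x)%N.
Proof.
move=> xy; apply/subset_leq_card/subsetP=> i; rewrite !inE => /andP[-> ix].
exact: leq_trans xy ix.
Qed.

Lemma ltn_row_cut x a : (a < #|~: v|)%N -> (a < row_cut x)%N = (x <= row_elt a)%N.
Proof.
move=> aP; rewrite /row_cut -(count_enum (~: v) (fun i => x <= i)%N) -count_rev.
apply: (sorted_count (r := relpre val (fun i j => j < i)%N)).
- by move=> z y t /= yz zt; apply: ltn_trans zt yz.
- by move=> y z /= /ltnW zy xz; apply: leq_trans xz zy.
- by rewrite rev_sorted; apply: sorted_enum_set.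
- by rewrite size_rows.
Qed.

Lemma ltn_col_cut x b : (b < d)%N -> (b < cut v x)%N = (col_elt b < x)%N.
Proof. by move=> bd; rewrite -[b]/(val (Ordinal bd)) ltn_cut col_eltE. Qed.

Lemma row_elt_decr a a' : (a < a')%N -> (a' < #|~: v|)%N -> (row_elt a' < row_elt a)%N.
Proof.
move=> aa' aP'; have tr : transitive (relpre val (fun i j => j < i)%N : rel 'I_n).
  by move=> z y t /= yz zt; apply: ltn_trans zt yz.
have sort_rows : sorted (relpre val (fun i j => j < i)%N) (rev (enum (~: v))).
  by rewrite rev_sorted; apply: sorted_enum_set.
have := sorted_ltn_nth tr r0 sort_rows; apply => //; rewrite inE size_rows //.
exact: ltn_trans aa' aP'.
Qed.

Lemma col_elt_incr b b' : (b < b')%N -> (b' < d)%N -> (col_elt b < col_elt b')%N.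
Proof.
move=> bb' bd'.
have := sorted_ltn_nth (@ltn_ord_trans n) r0 (sorted_enum_set v); apply => //;
  rewrite inE size_enum_Idn //; exact: ltn_trans bb' bd'.
Qed.

Lemma row_elt_inj a a' : (a < #|~: v|)%N -> (a' < #|~: v|)%N ->
  row_elt a = row_elt a' -> a = a'.
Proof.
move=> aP aP' e; case: (ltngtP a a') => // /row_elt_decr.
  by move=> /(_ aP'); rewrite e ltnn.
by move=> /(_ aP); rewrite e ltnn.
Qed.

Lemma col_elt_inj b b' : (b < d)%N -> (b' < d)%N -> col_elt b = col_elt b' -> b = b'.
Proof.
move=> bd bd' e; case: (ltngtP b b') => // /col_elt_incr.
  by move=> /(_ bd'); rewrite e ltnn.
by move=> /(_ bd); rewrite e ltnn.
Qed.

Lemma row_elt_surj r : r \notin v -> exists2 a, (a < #|~: v|)%N & row_elt a = r.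
Proof.
move=> rv; have rP : r \in rev (enum (~: v)) by rewrite mem_rev mem_enum inE.
exists (index r (rev (enum (~: v)))); last exact: nth_index.
by rewrite -size_rows index_mem.
Qed.

Lemma cell_monP x : in_rect #|~: v| d x ->
  exists2 b : Rtype v, Rpair b = (row_elt x.1, col_elt x.2)
                     & cell_mon x = U_(enum_rank b)%MM.
Proof.
case/andP=> xr xc; rewrite /cell_mon; case: insubP => [b _ bE|].
  by exists b.
by rewrite inE /= row_elt_notin ?col_elt_in.
Qed.

Lemma cell_mon_var x : in_rect #|~: v| d x -> exists i, cell_mon x = U_(i)%MM.
Proof. by case/cell_monP=> b _ ->; exists (enum_rank b). Qed.

Lemma cell_mon_inj x y : in_rect #|~: v| d x -> in_rect #|~: v| d y ->
  cell_mon x = cell_mon y -> x = y.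
Proof.
move=> xR yR; have [b bE ->] := cell_monP xR; have [b' bE' ->] := cell_monP yR.
move=> /mnmP/(_ (enum_rank b)); rewrite !mnm1E eqxx.
case: eqP => // /enum_rank_inj eb _; move: bE'; rewrite eb bE.
clear bE; case: x y xR yR => x1 x2 [y1 y2] /andP[/= ? ?] /andP[/= ? ?] [].
by move=> /row_elt_inj-> // /col_elt_inj->.
Qed.

Lemma Xvar_cell (k : fieldType) x : in_rect #|~: v| d x ->
  Xvar k v (row_elt x.1) (col_elt x.2) = 'X_[k, cell_mon x].
Proof.
case/andP=> xr xc; rewrite /Xvar /cell_mon; case: insubP => //.
by rewrite inE /= row_elt_notin ?col_elt_in.
Qed.

(* #{i in w, i >= x} - #{i in v, i >= x} is cut v x - cut w x. *)
Definition ladder_of (w : Idn d n) : seq (nat * nat * nat) :=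
  [seq (row_cut x, cut v x, (cut v x - cut w x).+1) | x <- iota 0 n.+1].

Lemma ladder_of_staircase w c c' : c \in ladder_of w -> c' \in ladder_of w ->
  staircase c c'.
Proof.
move=> /mapP[x _ ->] /mapP[y _ ->]; rewrite /staircase /=.
by case/orP: (leq_total x y) => xy; rewrite (row_cut_anti xy) (cut_mono v xy) ?orbT.
Qed.

(** At a threshold [x] with [cut theta x < cut w x], the determinant is expanded along the rows of
    [theta] below [x] and the columns of [v] from [x] on. The inequality leaves exactly enough room
    for minors of size [c.2]. *)
Lemma fpoly_ladder (k : fieldType) (w theta : Idn d n) :
    Idn_le v w -> ~~ Idn_le theta w ->
  ladder_ideal cell_mon (ladder_of w) (fpoly k v theta).
Proof.
move=> /Idn_leP le_vw /Idn_leN[x xn lt_x].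
pose c := (row_cut x, cut v x, (cut v x - cut w x).+1).
have cc : c \in ladder_of w by apply: map_f; rewrite mem_iota /= ltnS ltnW.
apply: (@det_in_ideal _ (@ladder_ideal k _ cell_mon (ladder_of w)) _ _ _ c.2 d _
  [set i | (elt theta i < x)%N] (~: [set j | (elt v j < x)%N])).
- exact: ideal_gen0.
- by move=> p q; apply: ideal_genD.
- by move=> a p; apply: ideal_genM.
- have := cardsC [set j | (elt v j < x)%N]; rewrite !card_elt_cut card_ord /=.
  by have := le_vw x; move: (#|_|) => N; clear -lt_x; lia.
move=> rho gam rP gP.
have {rP}rP i : (x <= elt theta (rho i))%N by have := rP i; rewrite inE -leqNgt.
have {gP}gP j : (elt v (gam j) < x)%N by have := gP j; rewrite !inE negbK.
(* A remaining row from [v] is zero: it is at least [x], so its unit entry sits in a discarded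
   column. *)
case: (boolP [exists i, elt theta (rho i) \in v]) => [/existsP[i iv]|Nv].
  rewrite (expand_det_row _ i) big1; first exact: ideal_gen0.
  move=> j _; rewrite !mxE iv; case: eqP => [e|_]; last by rewrite mul0r.
  by have := rP i; rewrite e leqNgt gP.
have rN i : elt theta (rho i) \notin v.
  by apply: contra Nv => iv; apply/existsP; exists i.
have [h hE] : exists h : 'I_c.2 -> nat, forall i,
    (h i < #|~: v|)%N /\ row_elt (h i) = elt theta (rho i).
  have ex i : exists a, (a < #|~: v|)%N /\ row_elt a = elt theta (rho i).
    by have [a] := row_elt_surj (rN i); exists a.
  exact: fin_all_exists ex.
rewrite (_ : mxsub _ _ _ = gmx k cell_mon c.2 c.2 (extend0 h)
                                (extend0 (fun j => gam j : nat))).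
  apply: (ladder_ideal_mem _ _ cc); apply: extend0_bound => i /=.
    by have [hP hi] := hE i; rewrite ltn_row_cut // hi.
  by rewrite ltn_cut.
apply/matrixP=> i j; rewrite !mxE !extend0E (negPf (rN i)).
have [hP <-] := hE i; rewrite -col_eltE -(@Xvar_cell k (h i, nat_of_ord (gam j))) //.
by rewrite /in_rect hP /=.
Qed.

(** * The subset attached to a chain *)

Section ChainSubset.

Variables (x : nat) (s : seq (nat * nat)).
Hypotheses (sort_s : sorted lt2 s) (sR : all (in_rect (row_cut x) (cut v x)) s).

Let ra i := (nth (0, 0)%N s i).1.
Let cb i := (nth (0, 0)%N s i).2.

Let rectP i : (i < size s)%N -> (ra i < row_cut x)%N /\ (cb i < cut v x)%N.
Proof. by move=> /(mem_nth (0, 0)%N)/(allP sR)/andP. Qed.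

Let raP i : (i < size s)%N -> (ra i < #|~: v|)%N.
Proof. by case/rectP=> lt_r _; apply: leq_trans lt_r (row_cut_le x). Qed.

Let cbP i : (i < size s)%N -> (cb i < d)%N.
Proof. by case/rectP=> _ lt_c; apply: leq_trans lt_c (cut_le_size v x). Qed.

Let row_geq i : (i < size s)%N -> (x <= row_elt (ra i))%N.
Proof. by move=> it; rewrite -ltn_row_cut ?raP //; case: (rectP it). Qed.

Let col_lt i : (i < size s)%N -> (col_elt (cb i) < x)%N.
Proof. by move=> it; rewrite -ltn_col_cut ?cbP //; case: (rectP it). Qed.

Let chain_lt i j : (i < j)%N -> (j < size s)%N -> (ra i < ra j)%N /\ (cb i < cb j)%N.
Proof.
move=> ij js; have js' : (i + (j - i) < size s)%N by rewrite subnKC // ltnW.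
have [] := chain_gap sort_s js'; rewrite (subnKC (ltnW ij)) => h1 h2.
by split; [apply: leq_trans _ h1 | apply: leq_trans _ h2];
  rewrite -addn1 leq_add2l subn_gt0.
Qed.

Let cb_inj i j : (i < size s)%N -> (j < size s)%N -> cb i = cb j -> i = j.
Proof.
move=> it jt e; case: (ltngtP i j) => // /chain_lt.
  by move=> /(_ jt)[_]; rewrite e ltnn.
by move=> /(_ it)[_]; rewrite e ltnn.
Qed.

Let ra_inj i j : (i < size s)%N -> (j < size s)%N -> ra i = ra j -> i = j.
Proof.
move=> it jt e; case: (ltngtP i j) => // /chain_lt.
  by move=> /(_ jt)[]; rewrite e ltnn.
by move=> /(_ it)[]; rewrite e ltnn.
Qed.

(** The column of each cell of the chain is exchanged for its row, and [theta] is the image.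
    Indexing by positions in [v] makes the untouched rows of the matrix unit rows with their 1 on
    the diagonal. *)
Let phi (j : 'I_d) : 'I_n :=
  if (j : nat) \in map snd s then row_elt (ra (index (j : nat) (map snd s)))
  else elt v j.

Let phi_col (j : 'I_d) i : (i < size s)%N -> j = cb i :> nat -> phi j = row_elt (ra i).
Proof.
move=> it jE; have it' : (i < size (map snd s))%N by rewrite size_map.
have cbE l : (l < size s)%N -> nth 0%N (map snd s) l = cb l.
  by move=> lt; rewrite (nth_map (0, 0)%N).
have js : (j : nat) \in map snd s by rewrite jE -cbE // mem_nth.
rewrite /phi js; congr (row_elt (ra _)); apply: cb_inj => //.
  by rewrite -(size_map snd) index_mem.
by rewrite -cbE -?(size_map snd) ?index_mem // nth_index.
Qed.

Let phi_elt (j : 'I_d) : (j : nat) \notin map snd s -> phi j = elt v j.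
Proof. by rewrite /phi => /negPf->. Qed.

Let phiP (j : 'I_d) :
  (exists2 i, (i < size s)%N & j = cb i :> nat) \/ (j : nat) \notin map snd s.
Proof.
case: (boolP ((j : nat) \in map snd s)) => [/(nthP 0%N)[i]|]; last by right.
by rewrite size_map => it; rewrite (nth_map (0, 0)%N) // => e; left; exists i.
Qed.

Let phi_inj : injective phi.
Proof.
move=> j j'; case: (phiP j) => [[i it jE]|jN]; case: (phiP j') => [[i' it' jE']|jN'].
- rewrite (phi_col it jE) (phi_col it' jE') => /row_elt_inj.
  move=> /(_ (raP it) (raP it'))/ra_inj e; apply/val_inj => /=.
  by rewrite jE jE' e.
- rewrite (phi_col it jE) (phi_elt jN') => e.
  by have := row_elt_notin (raP it); rewrite e elt_in.
- rewrite (phi_elt jN) (phi_col it' jE') => e.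
  by have := row_elt_notin (raP it'); rewrite -e elt_in.
- by rewrite !phi_elt //; apply: elt_inj.
Qed.

Let theta_card : #|[set phi j | j : 'I_d]| == d.
Proof. by rewrite card_imset // card_ord. Qed.

Let theta : Idn d n := MkIdn theta_card.

Let rs := [seq row_elt y.1 | y <- s].
Let cs := [seq col_elt y.2 | y <- s].

Let thetaD : theta :\: v =i rs.
Proof.
move=> r; rewrite inE; apply/andP/idP=> [[rv /imsetP[j _ rE]]|].
  case: (phiP j) => [[i it jE]|jN]; last by rewrite rE phi_elt ?elt_in in rv.
  rewrite rE (phi_col it jE) /ra; apply: (map_f (fun y => row_elt y.1)).
  exact: mem_nth.
case/mapP=> y /(nthP (0, 0)%N)[i it <-] ->; split; first exact: row_elt_notin (raP it).
apply/imsetP; exists (Ordinal (cbP it)) => //.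
by rewrite (@phi_col _ i).
Qed.

Let vD : v :\: theta =i cs.
Proof.
move=> c; rewrite inE; apply/andP/idP=> [[cN /elt_surj[j jE]]|].
  case: (phiP j) => [[i it ji]|jN]; last first.
    by case/negP: cN; apply/imsetP; exists j; rewrite ?phi_elt.
  rewrite -jE -col_eltE ji /cb; apply: (map_f (fun y => col_elt y.2)).
  exact: mem_nth.
case/mapP=> y /(nthP (0, 0)%N)[i it <-] ->; split; last exact: col_elt_in (cbP it).
apply/imsetP=> -[j _ jE]; have := col_elt_in (cbP it); rewrite -/(cb i) in jE *.
rewrite jE; case: (phiP j) => [[i' it' ji]|jN].
  by rewrite (phi_col it' ji) (negPf (row_elt_notin (raP it'))).
move=> _; move: jE; rewrite (phi_elt jN) -(col_eltE j) => /col_elt_inj e.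
case/negP: jN; rewrite -(e (cbP it) (ltn_ord j)) /cb.
by apply: (map_f snd); apply: mem_nth.
Qed.

Let rs_geq r : r \in rs -> (x <= r)%N.
Proof. by case/mapP=> y /(nthP (0, 0)%N)[i it <-] ->; apply: row_geq. Qed.

Let cs_lt c : c \in cs -> (c < x)%N.
Proof. by case/mapP=> y /(nthP (0, 0)%N)[i it <-] ->; apply: col_lt. Qed.

(** Below [x] the exchange only removes elements, and from [x] on it only adds some. Hence
    thresholds up to [x] are treated by counting the elements below them, later ones by counting
    those from them on. *)
Let theta_ge : Idn_le v theta.
Proof.
have cut_compl (a : Idn d n) y : (cut a y + #|[set i in a | y <= i]| = d)%N.
  rewrite -[RHS](card_Idn a) -(cardsID [set i : 'I_n | (i < y)%N] a).
  by congr (_ + _)%N; apply: eq_card => i; rewrite !inE -?leqNgt // andbC.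
apply/Idn_leP=> y; case: (leqP y x) => [yx|xy].
  apply/subset_leq_card/subsetP=> r; rewrite !inE => /andP[rt ry]; rewrite ry andbT.
  apply/negPn/negP=> rv; have /rs_geq : r \in rs by rewrite -thetaD inE rv rt.
  by rewrite leqNgt (leq_trans ry yx).
have: (#|[set i in v | (y <= i)%N]| <= #|[set i in theta | (y <= i)%N]|)%N.
  apply/subset_leq_card/subsetP=> r; rewrite !inE => /andP[rv ry]; rewrite ry andbT.
  apply/negPn/negP=> rt; have /cs_lt : r \in cs by rewrite -vD inE rv rt.
  by rewrite ltnNge (leq_trans (ltnW xy) ry).
by have := cut_compl v y; have := cut_compl theta y; lia.
Qed.

Let sorted_cs : sorted (relpre val ltn) cs.
Proof.
apply/(sortedP r0) => i; rewrite size_map => it.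
rewrite !(nth_map (0, 0)%N) //=; last exact: ltnW.
by apply: col_elt_incr; [case: (chain_lt (ltnSn i) it) | apply: cbP].
Qed.

Let sorted_rs : sorted (relpre val (fun i j => j < i)%N) rs.
Proof.
apply/(sortedP r0) => i; rewrite size_map => it.
rewrite !(nth_map (0, 0)%N) //=; last exact: ltnW.
by apply: row_elt_decr; [case: (chain_lt (ltnSn i) it) | apply: raP].
Qed.

(** Below [x] nothing enters, and the [size s] columns of the chain leave [v]. *)
Let theta_cut : (cut theta x + size s <= cut v x)%N.
Proof.
have ucs : uniq cs.
  apply: sorted_uniq sorted_cs; first exact: ltn_ord_trans.
  by move=> i /=; rewrite ltnn.
rewrite -(size_map (fun y => col_elt y.2) s) -/cs -(card_uniqP ucs).
rewrite /cut -(cardsE (mem cs)) -cardsUI.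
set T := [set i in theta | _]; set C := [set i in _].
have -> : T :&: C = set0.
  apply/setP=> i; rewrite !inE; apply/negP=> /andP[/andP[it _]].
  by rewrite -vD !inE it.
rewrite cards0 addn0; apply/subset_leq_card/subsetP=> i; rewrite !inE.
case/orP=> [/andP[it ix]|ics]; last first.
  by rewrite cs_lt // andbT; move: ics; rewrite -vD inE => /andP[].
rewrite ix andbT; apply/negPn/negP=> iv.
have /rs_geq : i \in rs by rewrite -thetaD inE iv it.
by rewrite leqNgt ix.
Qed.

(** Sorting the rows of [theta] costs the sign of a permutation, and [det_unit_rows] removes the
    rows outside the chain. *)
Let theta_fpoly (k : fieldType) :
  exists b : bool, fpoly k v theta = (-1) ^+ b * chain_minor k cell_mon s.
Proof.
have phi_theta j : exists i, elt theta i = phi j.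
  by apply: elt_surj; apply/imsetP; exists j.
have [sg sgE] := fin_all_exists phi_theta.
have sg_inj : injective sg.
  by move=> i j e; apply: phi_inj; rewrite -!sgE e.
exists (perm sg_inj); pose M := rowsub phi (generic_mx k v).
have -> : fpoly k v theta = (-1) ^+ perm sg_inj * \det M.
  rewrite /fpoly (_ : M = row_perm (perm sg_inj) (rowsub (elt theta) (generic_mx k v))).
    by rewrite row_permE det_mulmx det_perm mulrA -signr_addb addbb mul1r.
  by apply/matrixP=> i j; rewrite !mxE permE sgE.
congr (_ * _); pose ka (i : 'I_(size s)) : 'I_d := Ordinal (cbP (ltn_ord i)).
rewrite (@det_unit_rows _ _ _ M ka).
- congr (\det _); apply/matrixP=> i j; rewrite !mxE (@phi_col _ i) //.
  rewrite (negPf (row_elt_notin (raP (ltn_ord i)))) -col_eltE.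
  rewrite -(@Xvar_cell k (ra i, cb j)) // /in_rect /=.
  by rewrite raP ?cbP.
- by move=> i j /(congr1 val) /= /cb_inj e; apply/val_inj/e.
- move=> i j iN; rewrite !mxE phi_elt ?elt_in ?(inj_eq (@elt_inj _ _ v)) //.
  case: (phiP i) => // -[l lt iE]; case/negP: iN; apply/codomP.
  by exists (Ordinal lt); apply: val_inj.
Qed.

(** Read backwards, the chain has increasing row elements and decreasing column elements, separated
    by [x]; this is the case of [greedy_nested]. *)
Let theta_Smon : Smon v theta = (\sum_(y <- s) cell_mon y)%MM.
Proof.
pose l := rev [seq (row_elt y.1, col_elt y.2) | y <- s].
have rsE : map fst l = rev rs by rewrite /l map_rev -map_comp.
have csE : map snd l = rev cs by rewrite /l map_rev -map_comp.
have SE : Sset v theta = l.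
  rewrite /Sset (_ : enum (theta :\: v) = map fst l).
    apply: greedy_nested; first by move=> c; rewrite vD csE mem_rev.
      have: sorted (fun i j : 'I_n => (j < i)%N) (map snd l).
        by rewrite csE rev_sorted; apply: sorted_cs.
      by rewrite sorted_map.
    move=> p q pl ql.
    have /rs_geq : q.1 \in rs by rewrite -mem_rev -rsE map_f.
    by apply: leq_trans; apply: cs_lt; rewrite -mem_rev -csE map_f.
  apply: (irr_sorted_eq (leT := relpre val ltn)).
  - exact: ltn_ord_trans.
  - by move=> i /=; rewrite ltnn.
  - exact: sorted_enum_set.
  - by rewrite rsE rev_sorted; apply: sorted_rs.
  - by move=> r; rewrite mem_enum thetaD rsE mem_rev.
apply/mnmP=> i; rewrite mnmE SE /l count_rev count_map mnm_sumE.
rewrite -sum1_count big_mkcond /= big_seq [RHS]big_seq; apply: eq_bigr => y ys.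
have /andP[yr yc] := allP sR y ys.
have yR : in_rect #|~: v| d y.
  by rewrite /in_rect (leq_trans yr (row_cut_le x)) (leq_trans yc (cut_le_size v x)).
have [b bE ->] := cell_monP yR; rewrite mnm1E -bE (inj_eq val_inj).
by rewrite (can2_eq enum_rankK enum_valK); case: (b == _).
Qed.

(** When [size s] exceeds [cut v x - cut w x], the inequality forces [theta] not to be below [w]. *)
Lemma chain_subset (k : fieldType) : exists theta : Idn d n,
  [/\ Idn_le v theta, (cut theta x + size s <= cut v x)%N,
      exists b : bool, fpoly k v theta = (-1) ^+ b * chain_minor k cell_mon s
    & Smon v theta = (\sum_(y <- s) cell_mon y)%MM].
Proof. by exists theta; split=> //; apply: theta_fpoly. Qed.

End ChainSubset.

End Grid.

(** * The Gröbner basis property *)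

Lemma init_term_sign (k : fieldType) N (le : rel 'X_{1..N}) (p : {mpoly k[N]}) m :
    init_term le p = 'X_[m] \/ init_term le p = - 'X_[m] ->
  p != 0 /\ init_mon le p = m.
Proof.
move=> ip; have nz : (init_term le p)@_m != 0.
  by case: ip => ->; rewrite ?mcoeffN mcoeffX eqxx ?oppr_eq0 oner_eq0.
split; first by apply: contraNneq nz => ->; rewrite /init_term mcoeff0 scale0r mcoeff0.
apply/eqP; apply: contraNT nz => ne.
by rewrite /init_term mcoeffZ mcoeffX (negPf ne) mulr0.
Qed.

Theorem proposition5p4 (k : fieldType) (d n : nat) (hd : (0 < d)%N)
    (hdn : (d <= n)%N) (v w : Idn d n) (hvw : Idn_le v w)
    (le : rel 'X_{1..nvars v}) (hle : term_order le)
    (hinit : forall theta : Idn d n, Idn_le v theta ->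
       init_term le (fpoly k v theta) = 'X_[Smon v theta] \/
       init_term le (fpoly k v theta) = - 'X_[Smon v theta]) :
  groebner_basis le
    [seq fpoly k v theta | theta <- enum {: Idn d n}
                         & Idn_le v theta && ~~ Idn_le theta w].
Proof.
set G := [seq _ | _ <- _ & _].
have GP g : g \in G -> exists2 theta : Idn d n, ~~ Idn_le theta w & g = fpoly k v theta.
  by case/mapP=> theta; rewrite mem_filter => /andP[/andP[_ ?] _] ->; exists theta.
(* [r0] is only a default value for [nth]; it exists because [d] is positive. *)
pose r0 := elt v (Ordinal hd); pose u := cell_mon v r0; pose cs := ladder_of v w.
have u_var := @cell_mon_var d n v r0; have u_inj := @cell_mon_inj d n v r0.
have rect_le x : (row_cut v x <= #|~: v|)%N /\ (cut v x <= d)%N.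
  by rewrite row_cut_le cut_le_size.
have csP c : c \in cs ->
    [/\ (c.1.1 <= #|~: v|)%N, (c.1.2 <= d)%N & diagonal_init k le u c.1.1 c.1.2].
  case/mapP=> x _ -> /=; have [-> ->] := rect_le x; split=> // s sort_s sR.
  have [theta [le_v _ [b fE] SE]] := chain_subset r0 sort_s sR k.
  have [f0 fI] := init_term_sign (hinit theta le_v).
  rewrite fE -SE mulr_sign in f0 fI *; case: b f0 fI {fE} => //.
  by rewrite oppr_eq0 init_monN.
(* The ideal is enlarged to the ladder ideal, whose initial monomials contain long chains;
   [chain_subset] turns such a chain into a member of the given family whose [Smon] divides. *)
have ideal_mon p : ideal_gen (fun g => g \in G) p -> p != 0 ->
    exists2 theta, theta \in [pred t : Idn d n | Idn_le v t && ~~ Idn_le t w]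
                 & (Smon v theta <= init_mon le p)%MM.
  move=> Gp p0; have Lp : ladder_ideal u cs p.
    apply: ideal_gen_ind Gp; first exact: ideal_gen0.
    - by move=> p1 p2; apply: ideal_genD.
    - by move=> a p1; apply: ideal_genM.
    - by move=> g /GP[theta theta_w ->]; apply: fpoly_ladder.
  have [c cc [s [sort_s c_s sR sm]]] :=
    ladder_groebner hle u_var u_inj csP (@ladder_of_staircase d n v w) Lp p0.
  case/mapP: cc => x _ cE; rewrite {c}cE /= in c_s sR.
  have [theta [le_v cut_t _ SE]] := chain_subset r0 sort_s sR k.
  exists theta; last first.
    rewrite SE; apply: sum_cells_le u_var u_inj _ _ _ _ _ => //.
    have [le1 le2] := rect_le x.
    by apply: sub_all sR => y; apply: in_rect_sub.
  rewrite inE le_v; apply/negP=> /Idn_leP/(_ x); have /Idn_leP/(_ x) := hvw.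
  by clear -cut_t c_s; lia.
move=> p; split.
  apply: ideal_gen_ind; first exact: ideal_gen0.
  - by move=> p1 p2; apply: ideal_genD.
  - by move=> a p1; apply: ideal_genM.
  move=> _ [q Gq ->]; have [->|q0] := eqVneq q 0.
    by rewrite /init_term mcoeff0 scale0r; apply: ideal_gen0.
  have [theta thetaP le_m] := ideal_mon q Gq q0.
  have /andP[le_v theta_w] := thetaP.
  have fG : fpoly k v theta \in G.
    by apply: map_f; rewrite mem_filter le_v theta_w mem_enum.
  have [b bE] : exists b : bool,
      'X_[Smon v theta] = (-1) ^+ b * init_term le (fpoly k v theta).
    case: (hinit theta le_v) => ->; [exists false | exists true].
      by rewrite mul1r.
    by rewrite mulN1r opprK.
  rewrite /init_term -[init_mon le q](submK le_m) mpolyXD bE -/(init_term _ _).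
  rewrite -mul_mpolyC !mulrA; apply: ideal_genM; apply: ideal_gen_mem.
  by exists (fpoly k v theta).
apply: ideal_gen_ind; first exact: ideal_gen0.
- by move=> p1 p2; apply: ideal_genD.
- by move=> a p1; apply: ideal_genM.
move=> _ [g gG ->]; apply: ideal_gen_mem; exists g => //.
exact: ideal_gen_mem.
Qed.
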